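(* Let $G$ be a connected, simply connected Lie group with Lie algebra $\mathfrak{g}$ such that the quotient algebra $\mathfrak{g}/[\mathfrak{g},\mathfrak{g}]$ is non-trivial, of dimension $n$. Let $\Phi:G\to\mathbb{R}^n$ be the natural group epimorphism and let $g$ be a left-invariant Riemannian metric on $G$ such that $\Phi:(G,g)\to\mathbb{R}^n$ is a Riemannian submersion onto the standard Euclidean space $\mathbb{R}^n$. For the canonical basis $\{e_1,\dots,e_n\}$ of $\mathbb{R}^n$ let $\{X_1,\dots,X_n\}$ be the orthonormal basis of the horizontal space $\mathcal{H}_e=(\ker d\Phi_e)^\perp\subset\mathfrak{g}$ with $d\Phi_e(X_i)=e_i$, and define the vector $\xi\in\mathbb{C}^n$ by $$\xi=(\operatorname{trace}\operatorname{ad}_{X_1},\dots,\operatorname{trace}\operatorname{ad}_{X_n}).$$ For a maximal isotropic subspace $W$ of $\mathbb{C}^n$ put $V=\{w\in W\mid (w,\xi)=0\}$. If the dimension of the isotropic subspace $V$ is at least $2$, then $$\Omega_V=\{\phi_v:G\to\mathbb{C},\ \phi_v(x)=(\Phi(x),v)\mid v\in V\}$$ is an orthogonal family of globally defined harmonic morphisms on $(G,g)$.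
   Context: Natural group epimorphism: fix a Lie algebra isomorphism $\psi:\mathfrak{g}/[\mathfrak{g},\mathfrak{g}]\to\mathbb{R}^n$ (both are Abelian); $\Phi:G\to\mathbb{R}^n$ is the unique Lie group homomorphism whose differential at $e$ is the composition of the projection $\mathfrak{g}\to\mathfrak{g}/[\mathfrak{g},\mathfrak{g}]$ with $\psi$. $(\cdot,\cdot)$ denotes the standard symmetric complex bilinear form on $\mathbb{C}^n$. A subspace $W\subset\mathbb{C}^n$ is isotropic if the form vanishes identically on $W$; maximal isotropic means maximal among isotropic subspaces. For complex-valued functions on a Riemannian manifold $(M,g)$, $\tau$ is the Laplacian and $\kappa(\phi,\psi)=g(\operatorname{grad}\phi,\operatorname{grad}\psi)$, where $g$ is extended complex bilinearly to $T^{\mathbb{C}}M$. A function $\phi:M\to\mathbb{C}$ is a harmonic morphism if and only if $\tau(\phi)=0$ and $\kappa(\phi,\phi)=0$. A set $\Omega$ of functions $M\to\mathbb{C}$ is an orthogonal family of harmonic morphisms (orthogonal harmonic family) if $\tau(\phi)=0$ and $\kappa(\phi,\psi)=0$ for all $\phi,\psi\in\Omega$. *)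

(* Defs.v *)
From HB Require Import structures.
From mathcomp Require Import all_boot all_order all_algebra.
From mathcomp Require Import generic_quotient ring_quotient complex.
From mathcomp Require Import all_classical all_reals all_analysis.

Set Implicit Arguments.
Unset Strict Implicit.
Unset Printing Implicit Defensive.

Import Order.TTheory GRing.Theory Num.Theory.
Import numFieldNormedType.Exports.

Local Open Scope classical_set_scope.
Local Open Scope ring_scope.
Local Open Scope quotient_scope.
Local Open Scope complex_scope.

(* Over R this is the Euclidean product, over R[i] the standard symmetric
   complex bilinear form (no conjugation). *)
Definition bform (K : comNzRingType) (n : nat) (z w : 'rV[K]_n) : K :=
  \sum_(i < n) z 0 i * w 0 i.

Definition isotropic (K : fieldType) (n : nat) (W : {vspace 'rV[K]_n}) : Prop :=
  forall z w, z \in W -> w \in W -> bform z w = 0.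

Definition maximal_isotropic (K : fieldType) (n : nat)
    (W : {vspace 'rV[K]_n}) : Prop :=
  isotropic W /\
  forall W' : {vspace 'rV[K]_n}, isotropic W' -> (W <= W')%VS -> W' = W.

Section BformLinear.
Variables (K : fieldType) (n : nat) (xi : 'rV[K]_n).

Definition bformr (w : 'rV[K]_n) : K^o := bform w xi.

Fact bformr_is_linear : linear bformr.
Proof.
move=> a u v; rewrite /bformr /bform scaler_sumr -big_split /=.
by apply: eq_bigr => i _; rewrite !mxE mulrDl -mulrA.
Qed.

HB.instance Definition _ :=
  GRing.isLinear.Build K 'rV[K]_n K^o *:%R bformr bformr_is_linear.

Definition annihilated (W : {vspace 'rV[K]_n}) : {vspace 'rV[K]_n} :=
  (W :&: lker (linfun bformr))%VS.

Fact mem_annihilated (W : {vspace 'rV[K]_n}) (w : 'rV[K]_n) :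
  (w \in annihilated W) = (w \in W) && (bform w xi == 0).
Proof. by rewrite memv_cap memv_ker lfunE. Qed.

End BformLinear.

(* The quotient of a module by a submodule. The library has the additive
   structure on {quot S}; we add the action of scalars. *)
Section QuotientModule.
Variables (K : nzRingType) (V : lmodType K) (S : submodClosed V).

(* an alias of S, which carries its closure under opposites *)
Definition submod_pred : {pred V} := S.

Fact submod_pred_zmod_closed : zmod_closed submod_pred.
Proof. exact: GRing.submod_closedB (submodClosedP S). Qed.

HB.instance Definition _ :=
  GRing.isZmodClosed.Build V submod_pred submod_pred_zmod_closed.

Definition quotmod := Quotient.quot submod_pred.

HB.instance Definition _ := GRing.Zmodule.on quotmod.
HB.instance Definition _ := EqQuotient.on quotmod.

Definition quotmod_proj (u : V) : quotmod := \pi u.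

Definition quotmod_scale (a : K) (x : quotmod) : quotmod :=
  quotmod_proj (a *: repr x).

Fact quotmod_projE (u v : V) : (quotmod_proj u == quotmod_proj v) = (u - v \in S).
Proof. by rewrite /quotmod_proj -Quotient.idealrBE. Qed.

Fact quotmod_projK (x : quotmod) : quotmod_proj (repr x) = x.
Proof. exact: reprK. Qed.

Fact quotmod_projD : {morph quotmod_proj : u v / u + v}.
Proof. by move=> u v; rewrite /quotmod_proj !piE. Qed.

Fact quotmod_projZ a u : quotmod_proj (a *: u) = quotmod_scale a (quotmod_proj u).
Proof.
apply/eqP; rewrite quotmod_projE -scalerBr rpredZ //.
by rewrite -quotmod_projE quotmod_projK.
Qed.

Fact quotmod_scaleA a b x :
  quotmod_scale a (quotmod_scale b x) = quotmod_scale (a * b) x.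
Proof. by rewrite -[x]quotmod_projK -!quotmod_projZ scalerA. Qed.

Fact quotmod_scale1 : left_id 1 quotmod_scale.
Proof. by move=> x; rewrite -[x]quotmod_projK -quotmod_projZ scale1r. Qed.

Fact quotmod_scaleDr : right_distributive quotmod_scale +%R.
Proof.
move=> a x y; rewrite -[x]quotmod_projK -[y]quotmod_projK.
by rewrite -quotmod_projD -!quotmod_projZ scalerDr quotmod_projD.
Qed.

Fact quotmod_scaleDl x : {morph quotmod_scale^~ x : a b / a + b}.
Proof.
move=> a b; rewrite -[x]quotmod_projK.
by rewrite -!quotmod_projZ scalerDl quotmod_projD.
Qed.

HB.instance Definition _ := GRing.Zmodule_isLmodule.Build K quotmod
  quotmod_scaleA quotmod_scale1 quotmod_scaleDr quotmod_scaleDl.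

Fact quotmod_proj_is_linear : linear quotmod_proj.
Proof. by move=> a u v; rewrite quotmod_projD quotmod_projZ. Qed.

HB.instance Definition _ :=
  GRing.isLinear.Build K V quotmod *:%R quotmod_proj quotmod_proj_is_linear.

End QuotientModule.

Definition path_connected (R : realType) (T : topologicalType) : Prop :=
  forall x y : T, exists p : R -> T,
    [/\ {within `[0, 1], continuous p}, p 0 = x & p 1 = y].

Definition simply_connected (R : realType) (T : topologicalType) : Prop :=
  path_connected R T /\
  forall p : R -> T, {within `[0, 1], continuous p} -> p 0 = p 1 ->
  exists H : R * R -> T,
    [/\ {within `[0, 1] `*` `[0, 1], continuous H},
        forall t, t \in `[0, 1] -> H (0, t) = p t,
        forall t, t \in `[0, 1] -> H (1, t) = p 0 &
        forall s, s \in `[0, 1] -> H (s, 0) = p 0 /\ H (s, 1) = p 0].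

(* Meant for U open and V finite-dimensional; values of f outside U, where a
   chart expression is arbitrary, play no role then. *)
Fixpoint Ck_on (R : realType) (V W : normedModType R) (k : nat) (U : set V)
    (f : V -> W) : Prop :=
  match k with
  | 0%N => forall x, U x -> {for x, continuous f}
  | k'.+1 => (forall x, U x -> differentiable f x) /\
             forall v : V, Ck_on k' U (fun x => 'D_v f x)
  end.

Definition smooth_on (R : realType) (V W : normedModType R) (U : set V)
  (f : V -> W) : Prop := forall k, Ck_on k U f.

(* chart_to is meaningful on chart_dom only, and chart_from on chart_im only. *)
Record chart (R : realType) (m : nat) (M : Type) := Chart {
  chart_dom : set M;
  chart_to : M -> 'rV[R]_m;
  chart_from : 'rV[R]_m -> M }.

Definition chart_im (R : realType) (m : nat) (M : Type) (c : chart R m M) :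
  set 'rV[R]_m := chart_to c @` chart_dom c.

Definition is_chart (R : realType) (m : nat) (M : topologicalType)
    (c : chart R m M) : Prop :=
  [/\ open (chart_dom c), open (chart_im c),
      forall x, chart_dom c x -> chart_from c (chart_to c x) = x,
      forall x, chart_dom c x -> {for x, continuous (chart_to c)} &
      forall y, chart_im c y -> {for y, continuous (chart_from c)}].

(* A smooth manifold of dimension m carries a distinguished chart around each
   point. The tangent space at x is R^m, a tangent vector being given by its
   coordinates in the chart chart_at x. *)
HB.mixin Record isSmoothManifold (R : realType) (m : nat) M of Topological M := {
  atlas : set (chart R m M);
  chart_at : M -> chart R m M;
  manifold_hausdorff : hausdorff_space M;
  manifold_second_countable : @second_countable M;
  atlas_chart : forall c, atlas c -> is_chart c;
  atlas_compatible : forall c d, atlas c -> atlas d ->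
    smooth_on (chart_to c @` (chart_dom c `&` chart_dom d))
      (chart_to d \o chart_from c);
  chart_at_atlas : forall x, atlas (chart_at x);
  chart_at_dom : forall x, chart_dom (chart_at x) x }.

#[short(type="smoothManifoldType")]
HB.structure Definition SmoothManifold (R : realType) (m : nat) :=
  {M of isSmoothManifold R m M & Topological M}.

Arguments atlas {R m s}.
Arguments chart_at {R m s}.

Section Manifold.
Variables (R : realType) (m : nat) (M : smoothManifoldType R m).
Implicit Types (c : chart R m M) (x : M) (X Y : M -> 'rV[R]_m).

Definition smooth (W : normedModType R) (f : M -> W) : Prop :=
  forall c, atlas c -> smooth_on (chart_im c) (f \o chart_from c).

Definition differential (W : normedModType R) (f : M -> W) x : 'rV[R]_m -> W :=
  'd (f \o chart_from (chart_at x)) (chart_to (chart_at x) x).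

(* from T_x M to coordinates in the chart c *)
Definition to_coord c x : 'rV[R]_m -> 'rV[R]_m := differential (chart_to c) x.

(* from coordinates in the chart c, over the point with coordinates y, to the
   tangent space at this point *)
Definition of_coord c (y : 'rV[R]_m) : 'rV[R]_m -> 'rV[R]_m :=
  'd (chart_to (chart_at (chart_from c y)) \o chart_from c) y.

Definition field_coord c X (y : 'rV[R]_m) : 'rV[R]_m :=
  to_coord c (chart_from c y) (X (chart_from c y)).

(* In coordinates, [X, Y]^j = X^i d_i Y^j - Y^i d_i X^j. *)
Definition lie_bracket X Y x : 'rV[R]_m :=
  let c := chart_at x in let y := chart_to c x in
  'd (field_coord c Y) y (X x) - 'd (field_coord c X) y (Y x).

Definition gram_coord (g : M -> 'rV[R]_m -> 'rV[R]_m -> R) c (y : 'rV[R]_m) :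
    'M[R]_m :=
  \matrix_(i, j) g (chart_from c y) (of_coord c y (delta_mx 0 i))
                                    (of_coord c y (delta_mx 0 j)).

Record riemannian_metric := RiemannianMetric {
  metric_form :> M -> 'rV[R]_m -> 'rV[R]_m -> R;
  metric_linear : forall x a u v w,
    metric_form x (a *: u + v) w = a * metric_form x u w + metric_form x v w;
  metric_sym : forall x u v, metric_form x u v = metric_form x v u;
  metric_pos : forall x u, u != 0 -> 0 < metric_form x u u;
  metric_smooth : forall c, atlas c -> forall i j,
    smooth_on (chart_im c) (fun y => gram_coord metric_form c y i j) }.

Variable g : riemannian_metric.

Definition gradient (f : M -> R) x : 'rV[R]_m :=
  get [set u | forall v, g x u v = differential f x v].

(* div X = |g|^(-1/2) d_i (|g|^(1/2) X^i) *)
Definition divergence X x : R :=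
  let c := chart_at x in let y := chart_to c x in
  let vol z := Num.sqrt (\det (gram_coord g c z)) in
  (vol y)^-1 *
  \sum_(i < m) 'D_(delta_mx 0 i) (fun z => vol z * field_coord c X z 0 i) y.

Definition laplacian (f : M -> R) x : R := divergence (gradient f) x.

(* Complexified tangent vectors at x are elements of C^m; g is extended complex
   bilinearly to them. *)
Definition metricC x (z w : 'rV[R[i]]_m) : R[i] :=
  let re := map_mx (@complex.Re R) in let im := map_mx (@complex.Im R) in
  (g x (re z) (re w) - g x (im z) (im w))
  +i* (g x (re z) (im w) + g x (im z) (re w)).

Definition gradientC (phi : M -> R[i]) x : 'rV[R[i]]_m :=
  \row_i (gradient (fun x' => complex.Re (phi x')) x 0 i
          +i* gradient (fun x' => complex.Im (phi x')) x 0 i).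

Definition tau (phi : M -> R[i]) x : R[i] :=
  laplacian (fun x' => complex.Re (phi x')) x
  +i* laplacian (fun x' => complex.Im (phi x')) x.

Definition kappa (phi psi : M -> R[i]) x : R[i] :=
  metricC x (gradientC phi x) (gradientC psi x).

Definition smoothC (phi : M -> R[i]) : Prop :=
  smooth (fun x => complex.Re (phi x)) /\ smooth (fun x => complex.Im (phi x)).

Definition orthogonal_harmonic_family (Omega : set (M -> R[i])) : Prop :=
  (forall phi, Omega phi -> smoothC phi) /\
  forall phi psi, Omega phi -> Omega psi ->
    (forall x, tau phi x = 0) /\ (forall x, kappa phi psi x = 0).

Definition horizontal (n : nat) (Phi : M -> 'rV[R]_n) x : set 'rV[R]_m :=
  [set u | forall v, differential Phi x v = 0 -> g x u v = 0].

Definition riemannian_submersion (n : nat) (Phi : M -> 'rV[R]_n) : Prop :=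
  [/\ smooth Phi,
      forall x w, exists u, differential Phi x u = w &
      forall x u v, horizontal Phi x u -> horizontal Phi x v ->
        bform (differential Phi x u) (differential Phi x v) = g x u v].

Definition orthonormal_basis (n : nat) x (H : set 'rV[R]_m)
    (X : 'I_n -> 'rV[R]_m) : Prop :=
  [/\ forall i, H (X i),
      forall i j, g x (X i) (X j) = (i == j)%:R &
      forall u, H u -> exists a : 'I_n -> R, u = \sum_(i < n) a i *: X i].

End Manifold.

HB.mixin Record isLieGroup (R : realType) (m : nat) G
    of Group G & SmoothManifold R m G := {
  lie_mul_continuous : continuous (fun p : G * G => (p.1 * p.2)%g);
  lie_inv_continuous : continuous (fun x : G => (x^-1)%g);
  lie_mul_smooth : forall a b c : chart R m G, atlas a -> atlas b -> atlas c ->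
    smooth_on
      [set p : 'rV[R]_m * 'rV[R]_m | [/\ chart_im a p.1, chart_im b p.2 &
         chart_dom c (chart_from a p.1 * chart_from b p.2)%g]]
      (fun p => chart_to c (chart_from a p.1 * chart_from b p.2)%g);
  lie_inv_smooth : forall a c : chart R m G, atlas a -> atlas c ->
    smooth_on
      [set y : 'rV[R]_m | chart_im a y /\ chart_dom c ((chart_from a y)^-1)%g]
      (fun y => chart_to c ((chart_from a y)^-1)%g) }.

#[short(type="lieGroupType")]
HB.structure Definition LieGroup (R : realType) (m : nat) :=
  {G of isLieGroup R m G & Group G & SmoothManifold R m G}.

Section LieGroupTheory.
Variables (R : realType) (m : nat) (G : lieGroupType R m).

(* the differential of z |-> x * z at y, from T_y G to T_(x * y) G *)
Definition dleft (x y : G) : 'rV[R]_m -> 'rV[R]_m :=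
  differential (fun z : G => chart_to (chart_at (x * y)%g) (x * z)%g) y.

Definition left_invariant_field (u : 'rV[R]_m) (x : G) : 'rV[R]_m :=
  dleft x 1%g u.

(* The Lie algebra of G is the tangent space at 1 with this bracket. *)
Definition lie_alg_bracket (u v : 'rV[R]_m) : 'rV[R]_m :=
  lie_bracket (left_invariant_field u) (left_invariant_field v) (1%g : G).

Definition trace_ad (u : 'rV[R]_m) : R := \tr (lin1_mx (lie_alg_bracket u)).

(* [g, g] is the linear span of the brackets, not merely the set of brackets. *)
Definition derived_alg : {pred 'rV[R]_m} := fun u =>
  `[< exists s : seq (R * 'rV[R]_m * 'rV[R]_m),
        u = \sum_(t <- s) t.1.1 *: lie_alg_bracket t.1.2 t.2 >].

Fact derived_alg_submod_closed : submod_closed derived_alg.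
Proof.
split=> [|a u v /asboolP[s ->] /asboolP[t ->]]; apply/asboolP.
  by exists [::]; rewrite big_nil.
exists ([seq (a * r.1.1, r.1.2, r.2) | r <- s] ++ t).
rewrite big_cat big_map /= scaler_sumr; congr (_ + _).
by apply: eq_bigr => r _; rewrite scalerA.
Qed.

HB.instance Definition _ := GRing.isSubmodClosed.Build R 'rV[R]_m derived_alg
  (GRing.submod_closed_semi derived_alg_submod_closed).

(* the quotient algebra g / [g, g]; its bracket is zero, so that its Lie algebra
   isomorphisms onto R^n are the linear bijections *)
Definition abelianization := quotmod derived_alg.

HB.instance Definition _ := GRing.Lmodule.on abelianization.

Definition abelianization_proj : 'rV[R]_m -> abelianization :=
  @quotmod_proj R 'rV[R]_m derived_alg.

Definition natural_epimorphism (n : nat)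
    (psi : {linear abelianization -> 'rV[R]_n}) (Phi : G -> 'rV[R]_n) : Prop :=
  [/\ smooth Phi,
      forall x y, Phi (x * y)%g = Phi x + Phi y &
      forall u, differential Phi (1%g : G) u = psi (abelianization_proj u)].

Definition left_invariant (g : riemannian_metric G) : Prop :=
  forall x y u v, g (x * y)%g (dleft x y u) (dleft x y v) = g y u v.

Definition coord_fun (n : nat) (Phi : G -> 'rV[R]_n) (v : 'rV[R[i]]_n) :
  G -> R[i] := fun x => bform (map_mx (real_complex R) (Phi x)) v.

End LieGroupTheory.

Arguments lie_alg_bracket {R m} G u v.
Arguments trace_ad {R m} G u.
Arguments abelianization {R m} G.

(* Main.v *)
(* The gradient of x |-> (Phi x, a) is the left-invariant field of the horizontal
   lift sum_i a_i X_i of a. Hence kappa (phi_v, phi_w) = (v, w), which vanishes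
   by isotropy, and tau (phi_v) is the divergence of a left-invariant field.

   The divergence of the left-invariant field E_u is - trace ad_u: if F is the
   matrix, in coordinates, of a left-invariant frame, then F g F^T is constant,
   so that sqrt (det g) is a constant multiple of 1 / |det F|, and the derivative
   of F along E_u is governed by the brackets [E_u, E_k]. These are
   left-invariant because second derivatives of left translations are symmetric.
   Therefore tau (phi_v) = - (v, xi). *)
Require Import Defs.
From mathcomp Require Import all_boot all_order all_algebra.
From mathcomp Require Import fingroup perm complex ring lra.
From mathcomp Require Import all_classical all_reals all_analysis.

Set Implicit Arguments.
Unset Strict Implicit.
Unset Printing Implicit Defensive.

Import Order.TTheory GRing.Theory Num.Theory.
Import numFieldNormedType.Exports.

Local Open Scope classical_set_scope.
Local Open Scope ring_scope.
Local Open Scope complex_scope.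

(** A tangent vector is given in the distinguished chart of its base point, and that chart varies
    with the point without any regularity. Hence nothing is differentiated in those coordinates:
    left translations are read between fixed charts ([lmul]), and a left-invariant field becomes
    [lfield], a partial derivative of the multiplication map in charts, whose smoothness makes it
    differentiable. The value - trace ad_u comes from a cancellation. Let J be the matrix of the
    differential of E_u in a chart, matrices acting on row vectors from the right. The formula
    [E_u, E_k] = dE_k(E_u) - dE_u(E_k) says that the derivative of F along E_u is ad_u F + F J. So
    the density 1 / |det F| contributes - trace ad_u - trace J to the divergence, while the
    components of E_u contribute trace J: the part that depends on the chart drops out. *)

Lemma is_diff_differentiable (R : realType) (V W : normedModType R) (f df : V -> W) (x : V) :
  is_diff x f df -> differentiable f x.
Proof. by case. Qed.

Lemma is_derive_val (R : realType) (V W : normedModType R) (f : V -> W) (x v : V) (df : W) :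
  is_derive x v f df -> 'D_v f x = df.
Proof. by case. Qed.

Lemma is_diffE (R : realType) (V W : normedModType R) (f df : V -> W) (x v : V) :
  is_diff x f df -> 'd f x v = df v.
Proof. by move=> h; rewrite -[in RHS](@diff_val _ _ _ _ _ _ _ h). Qed.

Lemma is_diff_derive (R : realType) (V W : normedModType R) (f df : V -> W)
    (x v : V) :
  is_diff x f df -> is_derive x v f (df v).
Proof.
move=> [fx <-]; apply: DeriveDef; first exact: diff_derivable.
exact: deriveE.
Qed.

(** * Local nature of the differential *)

Section LocalDifferential.
Variables (R : realType) (V W : normedModType R).

(** The first-order expansion at [x] depends only on the germ at [x]. This is used throughout, since
    identities between chart expressions hold only near a point. *)
Lemma near_eq_is_diff (f g df : V -> W) (x : V) :
  (\forall z \near x, f z = g z) -> is_diff x f df -> is_diff x g df.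
Proof.
move=> fg [fx <-].
have [cf fE] := (diff_locallyP x f).1 fx.
have gE : g \o shift x = cst (g x) + 'd f x +o_ (0 : V) id.
  apply/eqaddoP => e e0.
  move/eqaddoP: fE => /(_ e e0) fE.
  have fg0 := nbhs_singleton fg.
  move: fg; rewrite (near_shift 0 x) subr0 => fg.
  near=> h.
  have E1 : f (h + x) = g (h + x).
    by have := near fg h; rewrite /=; apply.
  have : `|(f \o shift x - (cst (f x) + 'd f x)) h| <= e * `|h| by exact: (near fE h).
  by rewrite !fctE /= E1 fg0.
have gd : 'd g x = 'd f x :> (V -> W) by exact: diff_unique.
apply: DiffDef; last exact: gd.
by apply/diff_locallyP; split; rewrite gd; [exact: cf|exact: gE].
Unshelve. all: by end_near. Qed.

Lemma is_derive_line (f : V -> W) (u y : V) (s : R) :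
  differentiable f (s *: u + y) ->
  is_derive s 1 (fun t => f (t *: u + y)) ('D_u f (s *: u + y)).
Proof.
move=> fd.
have h : is_diff s (fun t : R => t *: u + y) (fun t => t *: u).
  apply: is_diff_eq.
  by rewrite funeqE => t /=; rewrite addr0.
have h2 : is_diff s (f \o (fun t : R => t *: u + y)) ('d f (s *: u + y) \o (fun t => t *: u)).
  apply: is_diff_comp; exact: differentiableP.
have := @is_diff_derive R R^o W _ _ s (1 : R) h2; rewrite /= scale1r deriveE//.
Qed.

End LocalDifferential.

(** * Symmetry of second derivatives *)

Section SecondDerivative.
Variables (R : realType) (V : normedModType R).

(* Mean value theorem for s |-> f (x + s u + t v) - f (x + s u) on [0, t]; only
   differentiability of 'D_u f at the single point x is needed, not continuity of
   second derivatives. *)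
Lemma second_difference_le (f : V -> R) (x u v : V) (e : R) :
  (\forall z \near x, differentiable f z) -> differentiable ('D_u f) x -> 0 < e ->
  \forall t \near (0 : R)^'+,
    `|f (t *: u + (t *: v + x)) - f (t *: u + x) - f (t *: v + x) + f x
      - t ^+ 2 * 'D_v ('D_u f) x| <= e * t ^+ 2.
Proof.
move=> fd gd e0.
set g := 'D_u f in gd *.
(* The approximation errors of [g] at [c *: u + t *: v] and at [c *: u], with [c <= t], will add up
   to at most [e / K * (t * K)]. The same [K] bounds the distance of these points from [x], and the
   summand 1 makes it positive. *)
have K0 : 0 < 2 * `|u| + `|v| + 1 by rewrite ltr_wpDl// addr_ge0// mulr_ge0.
set K := 2 * `|u| + `|v| + 1 in K0.
have [_] := (diff_locallyP x g).1 gd.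
move=> /eqaddoP /(_ (e / K)) /(_ (divr_gt0 e0 K0)) gE.
move: fd; rewrite (near_shift 0 x) subr0 /= => fd.
have [d /= d0 near_d] := (nbhs_normP _ _).1 (filterI gE fd).
near=> t.
have t0 : 0 < t by near: t; exact: nbhs_right_gt.
have td : t * K < d.
  by rewrite -ltr_pdivlMr//; near: t; apply: nbhs_right_lt; exact: divr_gt0.
have small (s : R) (w : V) : s \in `[0, t] -> `|w| <= t * `|v| ->
    ball_ Num.norm 0 d (s *: u + w).
  rewrite in_itv /= => /andP[s0 st] wv; rewrite /ball_ /= sub0r normrN.
  apply: le_lt_trans td; apply: (le_trans (ler_normD _ _)).
  rewrite normrZ (ger0_norm s0) /K !mulrDr mulr1.
  have : s * `|u| <= t * `|u| by rewrite ler_wpM2r.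
  have : 0 <= t * `|u| by rewrite mulr_ge0// ltW.
  lra.
have nv : `|t *: v| <= t * `|v| by rewrite normrZ gtr0_norm.
have n0 : `|0 : V| <= t * `|v| by rewrite normr0 mulr_ge0// ltW.
have fder (s : R) w : s \in `[0, t] -> `|w| <= t * `|v| ->
    is_derive s 1 (fun s => f (s *: u + (w + x))) (g (s *: u + (w + x))).
  move=> st wv; apply: is_derive_line.
  by have [_] := near_d _ (small s w st wv); rewrite /= -addrA.
have gest (s : R) w : s \in `[0, t] -> `|w| <= t * `|v| ->
    `|g (s *: u + (w + x)) - (g x + 'd g x (s *: u + w))| <= e / K * `|s *: u + w|.
  by move=> st wv; have [+ _] := near_d _ (small s w st wv); rewrite !fctE /= addrA.
(* The [0] is kept so that both terms are instances of [fder] and [gest], with [w = t *: v] and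
   [w = 0]. *)
pose phi s := f (s *: u + (t *: v + x)) - f (s *: u + (0 + x)).
pose dphi s := g (s *: u + (t *: v + x)) - g (s *: u + (0 + x)).
have phid s : s \in `[0, t] -> is_derive s 1 phi (dphi s).
  by move=> st; apply: is_deriveB; apply: fder.
have cphi : {within `[0, t], continuous phi}.
  apply: (@derivable_within_continuous R R^o) => s /phid h.
  exact: (@ex_derive _ _ _ _ _ _ _ h).
have dphi_oo s : s \in `]0, t[ -> is_derive s 1 phi (dphi s).
  by move=> st; apply: phid; apply: subset_itv_oo_cc st.
have [c ct Ephi] := MVT_segment (ltW t0) dphi_oo cphi.
move: Ephi; rewrite /phi !scale0r !add0r subr0 => Ephi.
rewrite (_ : _ + f x = dphi c * t); last by rewrite -Ephi; ring.
have g1 := gest c _ ct nv.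
have g2 := gest c _ ct n0.
have E1 : dphi c - t * 'D_v g x = 
   (g (c *: u + (t *: v + x)) - (g x + 'd g x (c *: u + t *: v)))
   - (g (c *: u + (0 + x)) - (g x + 'd g x (c *: u + 0))).
  have -> : 'd g x (c *: u + t *: v) = 'd g x (c *: u) + t * 'd g x v.
    by rewrite linearD [in X in _ + X]linearZ.
  by rewrite (addr0 (c *: u)) deriveE// /dphi; ring.
rewrite (_ : _ - _ = (dphi c - t * 'D_v g x) * t); last by ring.
rewrite normrM (gtr0_norm t0) expr2 mulrA E1.
apply: ler_wpM2r; first exact: ltW.
apply: (le_trans (ler_normB _ _)).
apply: (le_trans (lerD g1 g2)).
rewrite -mulrDr -mulrA; apply: ler_wpM2l; first exact: ltW.
rewrite mulrC ler_pdivrMr//.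
move: ct; rewrite in_itv /= => /andP[c0 ct].
have := ler_normD (c *: u) (t *: v).
have := ler_normD (c *: u) 0.
rewrite !normrZ (ger0_norm c0) (gtr0_norm t0) normr0 addr0.
have : c * `|u| <= t * `|u| by rewrite ler_wpM2r.
rewrite /K !mulrDr mulr1; lra.
Unshelve. all: by end_near. Qed.

(** The second difference is symmetric in [u] and [v], and each mixed derivative times [t ^+ 2] is
    within [e / 2 * t ^+ 2] of it. *)
Lemma derive_symmetric (f : V -> R) (x u v : V) :
  (\forall z \near x, differentiable f z) ->
  differentiable ('D_u f) x -> differentiable ('D_v f) x ->
  'D_v ('D_u f) x = 'D_u ('D_v f) x.
Proof.
move=> fd ud vd; apply/eqP; rewrite -subr_eq0 -normr_le0.
apply/ler_addgt0Pr => e e0; rewrite add0r.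
have e20 : 0 < e / 2 by rewrite divr_gt0.
have [t [t0 h1 h2]] : exists t : R, [/\ 0 < t,
    `|f (t *: u + (t *: v + x)) - f (t *: u + x) - f (t *: v + x) + f x
      - t ^+ 2 * 'D_v ('D_u f) x| <= e / 2 * t ^+ 2 &
    `|f (t *: v + (t *: u + x)) - f (t *: v + x) - f (t *: u + x) + f x
      - t ^+ 2 * 'D_u ('D_v f) x| <= e / 2 * t ^+ 2].
  have h1 := second_difference_le v fd ud e20.
  have h2 := second_difference_le u fd vd e20.
  near (0 : R)^'+ => t; exists t; split; first by near: t; exact: nbhs_right_gt.
    exact: (near h1 t).
  exact: (near h2 t).
have t20 : 0 < t ^+ 2 by rewrite exprn_gt0.
rewrite -(ler_pM2l t20) -[in leLHS](gtr0_norm t20) -normrM.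
move: h1 h2; rewrite (addrCA (t *: v) (t *: u)).
move: (f (t *: u + (t *: v + x))) (f (t *: u + x)) (f (t *: v + x)) (f x).
move: ('D_v ('D_u f) x) ('D_u ('D_v f) x) => D1 D2 a b c d h1 h2.
have -> : t ^+ 2 * (D1 - D2) =
    (a - c - b + d - t ^+ 2 * D2) - (a - b - c + d - t ^+ 2 * D1) by ring.
apply: (le_trans (ler_normB _ _)); apply: (le_trans (lerD h2 h1)); lra.
Unshelve. all: by end_near. Qed.
End SecondDerivative.

Lemma differentiable_is_derive (R : realType) (V W : normedModType R) (f : V -> W)
    (x v : V) : differentiable f x -> is_derive x v f ('D_v f x).
Proof. by move=> fx; apply: derivableP; exact: diff_derivable. Qed.

(** * Derivatives of sums, products and determinants; stability of C^k maps *)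

Section DerivativeRules.
Variables (R : realType) (V : normedModType R).

Lemma is_derive_mxP m n (M : V -> 'M[R]_(m, n)) (x v : V) (dM : 'M[R]_(m, n)) :
  is_derive x v M dM <->
  forall i j, is_derive x v (fun z => M z i j) (dM i j).
Proof.
split=> [[dx <-] i j|h].
  by apply: DeriveDef; [apply: (derivable_mxP M x v).1|rewrite derive_mx// mxE].
have dx : derivable M x v by apply/derivable_mxP => i j; have [] := h i j.
apply: DeriveDef => //; rewrite derive_mx//; apply/matrixP => i j; rewrite mxE.
by have [] := h i j.
Qed.

Lemma is_derive_bigsum (W : normedModType R) I (r : seq I) (h : I -> V -> W)
    (dh : I -> W) (x v : V) :
  (forall i, is_derive x v (h i) (dh i)) ->
  is_derive x v (fun z => \sum_(i <- r) h i z) (\sum_(i <- r) dh i).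
Proof.
move=> hd; elim: r => [|i r ih].
  rewrite big_nil (_ : (fun _ => _) = cst 0); first exact: is_derive_cst.
  by apply/funext => z; rewrite big_nil.
rewrite big_cons (_ : (fun _ => _) = h i + (fun z => \sum_(j <- r) h j z)).
  exact: is_deriveD.
by apply/funext => z; rewrite big_cons.
Qed.

(** The condition [j != i] removes every occurrence of [i], the product rule only one; hence
    [uniq r]. *)
Lemma is_derive_bigprod (I : eqType) (r : seq I) (h : I -> V -> R)
    (dh : I -> R) (x v : V) : uniq r ->
  (forall i, is_derive x v (h i) (dh i)) ->
  is_derive x v (fun z => \prod_(i <- r) h i z)
    (\sum_(i <- r) dh i * \prod_(j <- r | j != i) h j x).
Proof.
move=> + hd; elim: r => [_|i r ih /= /andP[ir /ih{}ih]].
  rewrite big_nil (_ : (fun _ => _) = cst 1); first exact: is_derive_cst.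
  by apply/funext => z; rewrite big_nil.
rewrite (_ : (fun _ => _) = h i * (fun z => \prod_(j <- r) h j z)); last first.
  by apply/funext => z; rewrite big_cons.
apply: is_derive_eq; rewrite big_cons addrC; congr (_ + _).
  rewrite big_cons eqxx /= [LHS]mulrC; congr (_ * _).
  rewrite big_seq [RHS]big_seq_cond; apply: eq_bigl => j.
  by case: eqVneq => [->|]; rewrite ?andbT// (negbTE ir).
rewrite [LHS]mulr_sumr; apply: eq_big_seq => j jr.
by rewrite big_cons (_ : i != j) 1?mulrCA//; apply: contraNneq ir => ->.
Qed.

(** A permutation other than the identity moves at least two points, so its term in the Leibniz
    expansion still has an off-diagonal entry of [1%:M] as a factor after one factor has been
    differentiated. *)
Lemma is_derive_det n (H : V -> 'M[R]_n) (dH : 'M[R]_n) (x v : V) :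
  is_derive x v H dH -> H x = 1%:M ->
  is_derive x v (fun z => \det (H z)) (\tr dH).
Proof.
move=> /is_derive_mxP hd H1.
rewrite /determinant.
have h : is_derive x v (fun z => \sum_(s : 'S_n) (-1) ^+ s * \prod_i H z i (s i))
  (\sum_(s : 'S_n) (-1) ^+ s *: \sum_i dH i (s i) * \prod_(j | j != i) H x j (s j)).
  apply: is_derive_bigsum => s.
  apply: (is_deriveZ ((-1) ^+ s)).
  apply: is_derive_bigprod; exact: index_enum_uniq.
apply: (is_derive_eq h).
rewrite (bigD1 (1%g : {perm _})) //= [X in _ + X]big1 ?addr0.
  rewrite odd_perm1 expr0 scale1r /mxtrace; apply: eq_bigr => i _.
  rewrite perm1 big1 ?mulr1// => j _.
  by rewrite H1 perm1 mxE eqxx.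
move=> s s1; rewrite big1 ?scaler0// => i _.
(* If the moved point [k] happens to be [i], its image [s i] is moved as well and differs from
   [i]. *)
have [j [ji sj]] : exists j, j != i /\ s j != j.
  have [k sk] : exists k, s k != k.
    apply/existsP; rewrite -negb_forall; apply: contra s1 => /forallP sid.
    by apply/eqP/permP => k; rewrite perm1; apply/eqP/sid.
  have [ki|] := eqVneq k i; last by exists k.
  by exists (s i); rewrite -ki sk; split=> //; rewrite (inj_eq perm_inj).
by rewrite (bigD1 j)//= H1 mxE eq_sym (negbTE sj) mul0r mulr0.
Qed.

Lemma derive_symmetric_mx m n (f : V -> 'M[R]_(m, n)) (x u v : V) :
  (\forall z \near x, differentiable f z) ->
  differentiable ('D_u f) x -> differentiable ('D_v f) x ->
  'D_v ('D_u f) x = 'D_u ('D_v f) x.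
Proof.
move=> fd ud vd.
have cd (M : V -> 'M[R]_(m, n)) z i j : differentiable M z ->
    differentiable (fun y => M y i j) z.
  move=> Md; apply: (@differentiable_comp _ _ _ _ M (fun N : 'M[R]_(m, n) => N i j)) => //.
  exact: differentiable_coord.
have ncd w i j : \forall z \near x,
    'D_w f z i j = 'D_w (fun y => f y i j) z.
  near=> z; rewrite derive_mx ?mxE//; apply: diff_derivable.
  exact: (near fd z).
have cE (M : V -> 'M[R]_(m, n)) w i j : differentiable M x ->
    'D_w M x i j = 'D_w (fun y => M y i j) x.
  move=> Md; have [Mx <-] := (is_derive_mxP _ _ _ _).1 (differentiable_is_derive w Md) i j.
  by [].
apply/matrixP => i j.
transitivity ('D_v (fun y => 'D_u f y i j) x); first exact: cE.
transitivity ('D_u (fun y => 'D_v f y i j) x); last by apply/esym; exact: cE.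
transitivity ('D_v ('D_u (fun y => f y i j)) x).
  exact: near_eq_derive (ncd u i j).
transitivity ('D_u ('D_v (fun y => f y i j)) x); last first.
  by apply/esym; exact: near_eq_derive (ncd v i j).
apply: derive_symmetric.
- near=> z; apply: cd; exact: (near fd z).
- have := near_eq_is_diff (ncd u i j) (differentiableP (cd _ x i j ud)).
  exact: is_diff_differentiable.
- have := near_eq_is_diff (ncd v i j) (differentiableP (cd _ x i j vd)).
  exact: is_diff_differentiable.
Unshelve. all: by end_near. Qed.

(** Openness of [U] turns equality on [U] into equality of germs, which passes to all
    derivatives. *)
Lemma Ck_on_eq (W : normedModType R) k (U : set V) (f g : V -> W) : open U ->
  (forall x, U x -> f x = g x) -> Ck_on k U f -> Ck_on k U g.
Proof.
move=> oU; elim: k f g => [|k ih] f g fg /=.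
  move=> fc x Ux; have fgx : \forall z \near x, f z = g z.
    by have := open_nbhs_nbhs (conj oU Ux); apply: filterS.
  suff : g @ x --> f x by rewrite (fg x Ux).
  apply: cvg_trans (fc x Ux).
  exact: near_eq_cvg.
have near_fg x : U x -> \forall z \near x, f z = g z.
  by move=> Ux; have := open_nbhs_nbhs (conj oU Ux); apply: filterS.
move=> [fd fk]; split=> [x Ux|v].
  have := near_eq_is_diff (near_fg x Ux) (differentiableP (fd x Ux)).
  exact: is_diff_differentiable.
apply: ih (fk v) => x Ux; apply: near_eq_derive; exact: near_fg.
Qed.

Lemma Ck_on_linear (W W' : normedModType R) k (U : set V) (f : V -> W)
    (l : {linear W -> W'}) :
  open U -> continuous l -> Ck_on k U f -> Ck_on k U (l \o f).
Proof.
move=> oU lc; elim: k f => [|k ih] f /=.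
  move=> fc x Ux; apply: continuous_comp; [exact: fc | exact: lc].
move=> [fd fk]; split=> [x Ux|v].
  apply: differentiable_comp; [exact: fd | exact: linear_differentiable].
apply: Ck_on_eq oU _ (ih _ (fk v)) => x Ux.
have fx := fd x Ux.
have ld : differentiable l (f x) by exact: linear_differentiable.
have lfd : is_diff x (l \o f) (l \o 'd f x).
  apply: is_diff_comp; first exact: differentiableP.
  by apply: DiffDef => //; exact: diff_lin.
by rewrite (is_derive_val (is_diff_derive v lfd)) /= deriveE.
Qed.

End DerivativeRules.

(** Differentiability is at hand for ['D_v T] with [v] fixed, so the moving vector [Y z] is expanded
    in the canonical basis and the product rule is applied to each term. *)
Lemma is_derive_diff_field (R : realType) m n (T : 'rV[R]_m -> 'rV[R]_n)
    (Y : 'rV[R]_m -> 'rV[R]_m) (x w dY : 'rV[R]_m) :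
  (\forall z \near x, differentiable T z) ->
  (forall v, differentiable ('D_v T) x) ->
  is_derive x w Y dY ->
  is_derive x w (fun z => 'd T z (Y z)) ('D_w ('D_(Y x) T) x + 'd T x dY).
Proof.
move=> Td T2d Yd.
have dE z y : differentiable T z -> 'd T z y = \sum_i y 0 i *: 'D_(delta_mx 0 i) T z.
  move=> Tz; rewrite {1}(row_sum_delta y) linear_sum; apply: eq_bigr => i _.
  by rewrite linearZ /= deriveE.
have Tx : differentiable T x by apply: (nbhs_singleton Td).
pose S z := \sum_i Y z 0 i *: 'D_(delta_mx 0 i) T z.
have TS : \forall z \near x, S z = 'd T z (Y z).
  near=> z; rewrite dE//; exact: (near Td z).
apply: (near_eq_is_derive TS).
have Sd : is_derive x w S (\sum_i (Y x 0 i *: 'D_w ('D_(delta_mx 0 i) T) x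
     + dY 0 i *: 'D_(delta_mx 0 i) T x)).
  apply: is_derive_bigsum => i.
  apply/is_derive_mxP => a b.
  rewrite (_ : (fun z => _) = (fun z => Y z 0 i) * (fun z => 'D_(delta_mx 0 i) T z a b)).
    have h1 := (is_derive_mxP _ _ _ _).1 Yd 0 i.
    have h2 := (is_derive_mxP _ _ _ _).1
      (differentiable_is_derive w (T2d (delta_mx 0 i))) a b.
    apply: is_derive_eq; rewrite !mxE; congr (_ + _); exact: mulrC.
  by apply/funext => z; rewrite !mxE.
apply: (is_derive_eq Sd).
rewrite big_split /=; congr (_ + _); last by rewrite dE.
(* The same expansion, now with the coefficients frozen at [x], reassembles the second
   derivatives. *)
have -> : 'D_w ('D_(Y x) T) x = 'D_w (fun z => \sum_i Y x 0 i *: 'D_(delta_mx 0 i) T z) x.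
  apply: near_eq_derive; near=> z.
  have Tz : differentiable T z by exact: (near Td z).
  by rewrite deriveE// dE.
apply/esym; apply: (is_derive_val (is_derive_bigsum (index_enum 'I_m)
  (fun i => is_deriveZ (Y x 0 i) (differentiable_is_derive w (T2d (delta_mx 0 i)))))).
Unshelve. all: by end_near. Qed.

(* Unification would otherwise unfold differentials whenever two of them differ. *)
#[local] Opaque diff.

Lemma is_diff_slicer (R : realType) (V V' W : normedModType R) (F : V * V' -> W) (a : V) (y : V') :
  differentiable F (a, y) ->
  is_diff y (fun z => F (a, z)) (fun v => 'd F (a, y) (0, v)).
Proof.
move=> Fd.
have h : is_diff y (fun z : V' => (a, z)) (fun v => (0, v)).
  by apply: is_diff_pair; exact: is_diff_id.
exact: (is_diff_comp h (differentiableP Fd)).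
Qed.

Lemma is_diff_slicel (R : realType) (V V' W : normedModType R) (F : V * V' -> W) (a : V) (y : V') :
  differentiable F (a, y) ->
  is_diff a (fun z => F (z, y)) (fun v => 'd F (a, y) (v, 0)).
Proof.
move=> Fd.
have h : is_diff a (fun z : V => (z, y)) (fun v => (v, 0)).
  by apply: is_diff_pair; exact: is_diff_id.
exact: (is_diff_comp h (differentiableP Fd)).
Qed.

Lemma chart_imP (R : realType) m (M : smoothManifoldType R m) (c : chart R m M) y :
  atlas c -> chart_im c y ->
  chart_dom c (chart_from c y) /\ chart_to c (chart_from c y) = y.
Proof. by move=> /atlas_chart[_ _ K _ _] [x xc <-]; rewrite K. Qed.

Lemma near_chart_im (R : realType) m (M : smoothManifoldType R m) (c : chart R m M) y :
  atlas c -> chart_im c y -> \forall z \near y, chart_im c z.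
Proof. by move=> /atlas_chart[_ oc _ _ _] yc; exact: open_nbhs_nbhs (conj oc yc). Qed.

(** * Left translations, left-invariant fields and their brackets in charts *)

Section LeftTranslation.
Variables (R : realType) (m : nat) (G : lieGroupType R m).
Implicit Types (a x : G) (c d e : chart R m G) (y z u v w : 'rV[R]_m).

(* Left translation by a, read from the chart c to the chart d; a change of
   charts is the case a = 1. *)
Definition lmul a c d y : 'rV[R]_m := chart_to d (a * chart_from c y)%g.

Definition unit_chart : chart R m G := chart_at (1%g : G).
Definition unit_coord : 'rV[R]_m := chart_to unit_chart (1%g : G).
Local Notation b := unit_chart.
Local Notation y1 := unit_coord.

Lemma chart_fromK c x : atlas c -> chart_dom c x -> chart_from c (chart_to c x) = x.
Proof. by move=> /atlas_chart[_ _ K _ _]; exact: K. Qed.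

Lemma chart_im_to c x : chart_dom c x -> chart_im c (chart_to c x).
Proof. by move=> xc; exists x. Qed.

(** Continuity of the multiplication makes the domain of a chart expression open, so that identities
    valid there can be differentiated. *)
Lemma near_lmul_dom a c d y : atlas c -> atlas d -> chart_im c y ->
  chart_dom d (a * chart_from c y)%g ->
  \forall z \near y, chart_im c z /\ chart_dom d (a * chart_from c z)%g.
Proof.
move=> ac ad yc yd; apply: filterI; first exact: near_chart_im.
have [_ _ _ _ /(_ _ yc) fc] := atlas_chart c ac.
have [od _ _ _ _] := atlas_chart d ad.
have [[A B] /= [nA nB] AB] := @lie_mul_continuous _ _ G (a, chart_from c y) _
  (open_nbhs_nbhs (conj od yd)).
apply: (@filterS _ (nbhs y) (nbhs_filter y) (chart_from c @^-1` B) _ _ (fc _ nB)) => z Bz.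
apply: (AB (a, chart_from c z)).
by split => //=; exact: nbhs_singleton nA.
Qed.

(** Smoothness of the multiplication is stated with charts on both factors; this exhibits a
    translation as a slice of that two-variable map, at the coordinates of [a]. *)
Lemma lmul_slice a c d y : lmul a c d y =
  chart_to d (chart_from (chart_at a) (chart_to (chart_at a) a) * chart_from c y)%g.
Proof. by rewrite chart_fromK//; [exact: chart_at_atlas|exact: chart_at_dom]. Qed.

Lemma differentiable_lmul a c d y : atlas c -> atlas d -> chart_im c y ->
  chart_dom d (a * chart_from c y)%g -> differentiable (lmul a c d) y.
Proof.
move=> ac ad yc yd.
have [Fd _] := @lie_mul_smooth _ _ G _ _ _ (chart_at_atlas a) ac ad 1%N.
rewrite (_ : lmul a c d = fun z => (fun p : 'rV[R]_m * 'rV[R]_m =>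
    chart_to d (chart_from (chart_at a) p.1 * chart_from c p.2)%g)
    (chart_to (chart_at a) a, z)); last by apply/funext => z; exact: lmul_slice.
apply: (is_diff_differentiable (is_diff_slicer (Fd _ _))).
split => //=; first exact: chart_im_to (chart_at_dom a).
by rewrite chart_fromK//; [exact: chart_at_atlas|exact: chart_at_dom].
Qed.

(** Near [y] the [v]-derivative of the slice is the [(0, v)]-derivative of the multiplication map,
    which is differentiable because that map is C^2. *)
Lemma differentiable_derive_lmul a c d y v : atlas c -> atlas d -> chart_im c y ->
  chart_dom d (a * chart_from c y)%g -> differentiable ('D_v (lmul a c d)) y.
Proof.
move=> ac ad yc yd.
have [Fd /(_ (0, v)) [F2d _]] := @lie_mul_smooth _ _ G _ _ _ (chart_at_atlas a) ac ad 2%N.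
set U := [set p | _] in Fd F2d.
set F := (fun p => chart_to _ _) in Fd F2d.
have inU z : chart_im c z -> chart_dom d (a * chart_from c z)%g ->
    U (chart_to (chart_at a) a, z).
  move=> zc zd; split => //=; first exact: chart_im_to (chart_at_dom a).
  by rewrite chart_fromK//; [exact: chart_at_atlas|exact: chart_at_dom].
have FE : lmul a c d = fun z => F (chart_to (chart_at a) a, z).
  by apply/funext => z; exact: lmul_slice.
have nE : \forall z \near y, 'D_(0, v) F (chart_to (chart_at a) a, z) = 'D_v (lmul a c d) z.
  near=> z.
  have [zc zd] : chart_im c z /\ chart_dom d (a * chart_from c z)%g.
    by near: z; exact: near_lmul_dom.
  have Fz := Fd _ (inU z zc zd).
  rewrite FE (is_derive_val (is_diff_derive v (is_diff_slicer Fz))).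
  exact: deriveE.
have := F2d _ (inU y yc yd) => /is_diff_slicer /(near_eq_is_diff nE) h.
exact: (is_diff_differentiable h).
Unshelve. all: by end_near. Qed.

(** By associativity, translations compose near [y] through any intermediate chart [d]. Changes of
    charts are translations by 1, so this one chain rule also serves for them. *)
Lemma is_diff_lmul_comp a a' c d e y : atlas c -> atlas d -> atlas e -> chart_im c y ->
  chart_dom d (a * chart_from c y)%g -> chart_dom e (a' * a * chart_from c y)%g ->
  is_diff y (lmul (a' * a)%g c e) ('d (lmul a' d e) (lmul a c d y) \o 'd (lmul a c d) y).
Proof.
move=> ac ad ae yc yd ye.
have nE : \forall z \near y, (lmul a' d e \o lmul a c d) z = lmul (a' * a)%g c e z.
  have := near_lmul_dom ac ad yc yd; apply: filterS => z [zc zd].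
  by rewrite /lmul /= chart_fromK// mulgA.
apply: (near_eq_is_diff nE).
apply: is_diff_comp; apply: differentiableP; first exact: differentiable_lmul.
apply: differentiable_lmul => //; first exact: chart_im_to.
by rewrite /lmul chart_fromK// mulgA.
Qed.

Lemma diff_lmul_comp a a' c d e y v : atlas c -> atlas d -> atlas e -> chart_im c y ->
  chart_dom d (a * chart_from c y)%g -> chart_dom e (a' * a * chart_from c y)%g ->
  'd (lmul (a' * a)%g c e) y v = 'd (lmul a' d e) (lmul a c d y) ('d (lmul a c d) y v).
Proof.
move=> ac ad ae yc yd ye; have h := is_diff_lmul_comp ac ad ae yc yd ye.
exact: (is_diffE v h).
Qed.

Lemma diff_lmul1 c y v : atlas c -> chart_im c y -> 'd (lmul 1%g c c) y v = v.
Proof.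
move=> ac yc.
have nE : \forall z \near y, id z = lmul 1%g c c z.
  have := near_chart_im ac yc; apply: filterS => z zc.
  by rewrite /lmul mul1g (chart_imP ac zc).2.
exact: (is_diffE v (near_eq_is_diff nE (is_diff_id y))).
Qed.

Lemma atlasb : atlas b. Proof. exact: chart_at_atlas. Qed.
Lemma dom_b1 : chart_dom b (1%g : G). Proof. exact: chart_at_dom. Qed.
Lemma im_y1 : chart_im b y1. Proof. exact: chart_im_to dom_b1. Qed.
Lemma from_y1 : chart_from b y1 = 1%g.
Proof. by rewrite chart_fromK; [|exact: atlasb|exact: dom_b1]. Qed.

Lemma lmul_y1 a d : lmul a b d y1 = chart_to d a.
Proof. by rewrite /lmul from_y1 mulg1. Qed.

Lemma lmulK a c d y : atlas d -> chart_dom d (a * chart_from c y)%g ->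
  chart_from d (lmul a c d y) = (a * chart_from c y)%g.
Proof. exact: chart_fromK. Qed.

(** The left-invariant field through [u] in the fixed chart [c]. It avoids the distinguished chart
    of the moving point, through which [field_coord] passes. *)
Definition lfield c u z : 'rV[R]_m := 'd (lmul (chart_from c z) b c) y1 u.

(** The field is the derivative of the multiplication map in its second factor at the identity; it
    is differentiated here with respect to the first factor. *)
Lemma differentiable_lfield c u z : atlas c -> chart_im c z -> differentiable (lfield c u) z.
Proof.
move=> ac zc.
have [Fd /(_ (0, u)) [F2d _]] := @lie_mul_smooth _ _ G _ _ _ ac atlasb ac 2%N.
set U := [set p | _] in Fd F2d.
set F := (fun p => chart_to _ _) in Fd F2d.
have inU z' : chart_im c z' -> U (z', y1).
  move=> zc'; split => //=; first exact: im_y1.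
  by rewrite from_y1 mulg1; exact: (chart_imP ac zc').1.
have nE : \forall z' \near z, 'D_(0, u) F (z', y1) = lfield c u z'.
  have := near_chart_im ac zc; apply: filterS => z' zc'.
  have Fz := Fd _ (inU _ zc').
  by rewrite deriveE// /lfield (is_diffE _ (is_diff_slicer Fz)).
have := F2d _ (inU z zc) => /is_diff_slicel /(near_eq_is_diff nE) h.
exact: (is_diff_differentiable h).
Qed.

Lemma to_coordE c x v : to_coord c x v =
  'd (lmul 1%g (chart_at x) c) (chart_to (chart_at x) x) v.
Proof.
rewrite /to_coord /differential (_ : _ \o _ = lmul 1%g (chart_at x) c)//.
by apply/funext => z; rewrite /lmul mul1g.
Qed.

Lemma of_coordE c y v : of_coord c y v =
  'd (lmul 1%g c (chart_at (chart_from c y))) y v.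
Proof.
rewrite /of_coord (_ : _ \o _ = lmul 1%g c (chart_at (chart_from c y)))//.
by apply/funext => z; rewrite /lmul mul1g.
Qed.

Lemma left_invariant_fieldE u x :
  left_invariant_field u x = 'd (lmul x b (chart_at x)) y1 u.
Proof. by rewrite /left_invariant_field /dleft mulg1. Qed.

(** The distinguished chart at the point cancels in the chain rule, applied to the translations by
    the point and by 1. *)
Lemma field_coord_left_invariant c u z : atlas c -> chart_im c z ->
  field_coord c (@left_invariant_field R m G u) z = lfield c u z.
Proof.
move=> ac zc; have [pc _] := chart_imP ac zc.
rewrite /field_coord /lfield; move: (chart_from c z) pc => p pc.
have dp : chart_dom (chart_at p) (p * chart_from b y1)%g.
  by rewrite from_y1 mulg1; exact: chart_at_dom.
have dc : chart_dom c (1 * p * chart_from b y1)%g by rewrite from_y1 mul1g mulg1.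
have := diff_lmul_comp u atlasb (chart_at_atlas p) ac im_y1 dp dc.
rewrite (lmul_y1 p (chart_at p)) (mul1g p) to_coordE left_invariant_fieldE.
by move/esym.
Qed.

(** Left invariance in coordinates, by the chain rule for the product of [a] and the point. *)
Lemma lfield_lmul a c d z u : atlas c -> atlas d -> chart_im c z ->
  chart_dom d (a * chart_from c z)%g ->
  lfield d u (lmul a c d z) = 'd (lmul a c d) z (lfield c u z).
Proof.
move=> ac ad zc zd; have [pc pz] := chart_imP ac zc.
rewrite /lfield lmulK//; move: (chart_from c z) pc pz zd => p pc pz zd.
have dc : chart_dom c (p * chart_from b y1)%g by rewrite from_y1 mulg1.
have dd : chart_dom d (a * p * chart_from b y1)%g by rewrite from_y1 mulg1.
have := diff_lmul_comp u atlasb ac ad im_y1 dc dd.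
by rewrite (lmul_y1 p c) pz.
Qed.

Lemma lfield_at1 u : lfield b u y1 = u.
Proof. by rewrite /lfield from_y1 diff_lmul1//; [exact: atlasb|exact: im_y1]. Qed.

(** This is the derivative along [w], at the identity, of the relation [lfield_lmul] for the
    translation by [x]. The second-derivative term is symmetric in [u] and [w], hence disappears
    from brackets. *)
Lemma diff_lfield_lmul x u w :
  'd (lfield (chart_at x) u) (chart_to (chart_at x) x)
    ('d (lmul x b (chart_at x)) y1 w) =
  'D_w ('D_u (lmul x b (chart_at x))) y1
  + 'd (lmul x b (chart_at x)) y1 ('d (lfield b u) y1 w).
Proof.
set c := chart_at x; set T := lmul x b c.
have ac : atlas c by exact: chart_at_atlas.
have xc : chart_dom c x by exact: chart_at_dom.
have domT : chart_dom c (x * chart_from b y1)%g by rewrite from_y1 mulg1.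
have Ty : T y1 = chart_to c x by rewrite /T /lmul from_y1 mulg1.
have nT := near_lmul_dom atlasb ac im_y1 domT.
have Td : differentiable T y1 by apply: differentiable_lmul => //; [exact: atlasb|exact: im_y1].
have Fcd : differentiable (lfield c u) (T y1).
  by apply: differentiable_lfield => //; rewrite Ty; exact: chart_im_to.
have Fbd : differentiable (lfield b u) y1.
  by apply: differentiable_lfield; [exact: atlasb|exact: im_y1].
have h1 := is_diff_derive w (is_diff_comp (differentiableP Td) (differentiableP Fcd)).
have h2 : is_derive y1 w (fun z => 'd T z (lfield b u z))
    ('D_w ('D_(lfield b u y1) T) y1 + 'd T y1 ('D_w (lfield b u) y1)).
  apply: is_derive_diff_field.
  - apply: filterS nT => z [zb zc]; apply: differentiable_lmul => //; exact: atlasb.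
  - by move=> v; apply: differentiable_derive_lmul => //; [exact: atlasb|exact: im_y1].
  - exact: differentiable_is_derive.
have nE : \forall z \near y1, 'd T z (lfield b u z) = (lfield c u \o T) z.
  by apply: filterS nT => z [zb zc] /=; rewrite lfield_lmul//; exact: atlasb.
have := near_eq_is_derive nE h2 => h3.
rewrite -Ty; transitivity ('D_w (lfield c u \o T) y1).
  by rewrite (is_derive_val h1).
by rewrite (is_derive_val h3) lfield_at1 (deriveE _ Fbd).
Qed.

Lemma lie_bracketE u v x :
  lie_bracket (left_invariant_field u) (left_invariant_field v) x =
  'd (lfield (chart_at x) v) (chart_to (chart_at x) x) ('d (lmul x b (chart_at x)) y1 u)
  - 'd (lfield (chart_at x) u) (chart_to (chart_at x) x) ('d (lmul x b (chart_at x)) y1 v).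
Proof.
have ac : atlas (chart_at x) by exact: chart_at_atlas.
have xc : chart_im (chart_at x) (chart_to (chart_at x) x).
  by apply: chart_im_to; exact: chart_at_dom.
have dE u' v' : 'd (field_coord (chart_at x) (left_invariant_field u'))
    (chart_to (chart_at x) x) v' =
    'd (lfield (chart_at x) u') (chart_to (chart_at x) x) v'.
  have nE : \forall z \near chart_to (chart_at x) x,
      lfield (chart_at x) u' z = field_coord (chart_at x) (left_invariant_field u') z.
    apply: filterS (near_chart_im ac xc) => z zc.
    by rewrite field_coord_left_invariant.
  have := near_eq_is_diff nE (differentiableP (differentiable_lfield u' ac xc)) => h.
  exact: (is_diffE v' h).
rewrite /lie_bracket; cbv zeta.
rewrite (left_invariant_fieldE u x) (left_invariant_fieldE v x).
exact: (f_equal2 (fun p q => p - q) (dE v _) (dE u _)).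
Qed.

Lemma lie_alg_bracketE u v :
  lie_alg_bracket G u v = 'd (lfield b v) y1 u - 'd (lfield b u) y1 v.
Proof.
rewrite /lie_alg_bracket lie_bracketE.
have E w : 'd (lmul 1%g b b) y1 w = w by exact: diff_lmul1 atlasb im_y1.
exact: (f_equal2 (fun p q => p - q) (congr1 ('d (lfield b v) y1) (E u))
  (congr1 ('d (lfield b u) y1) (E v))).
Qed.

Lemma lie_bracket_left_invariant u v x :
  lie_bracket (left_invariant_field u) (left_invariant_field v) x =
  left_invariant_field (lie_alg_bracket G u v) x.
Proof.
rewrite lie_bracketE left_invariant_fieldE lie_alg_bracketE.
have ac : atlas (chart_at x) by exact: chart_at_atlas.
have domT : chart_dom (chart_at x) (x * chart_from b y1)%g.
  by rewrite from_y1 mulg1; exact: chart_at_dom.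
have sym : 'D_u ('D_v (lmul x b (chart_at x))) y1 = 'D_v ('D_u (lmul x b (chart_at x))) y1.
  apply: derive_symmetric_mx.
  - apply: filterS (near_lmul_dom atlasb ac im_y1 domT) => z [zb zc].
    by apply: differentiable_lmul => //; exact: atlasb.
  - by apply: differentiable_derive_lmul => //; [exact: atlasb|exact: im_y1].
  - by apply: differentiable_derive_lmul => //; [exact: atlasb|exact: im_y1].
apply: (etrans (f_equal2 (fun p q => p - q) (diff_lfield_lmul x v u) (diff_lfield_lmul x u v))).
rewrite sym opprD addrACA subrr add0r.
exact: (esym (linearB _ _ _)).
Qed.

End LeftTranslation.

(** * Traces and determinants *)

Section Matrices.
Variable R : realType.

Lemma row_mulD m n p q (A : 'M[R]_(m, n)) (B : 'M[R]_(n, q)) (A' : 'M[R]_(m, p))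
    (B' : 'M[R]_(p, q)) i :
  row i (A *m B + A' *m B') = row i A *m B + row i A' *m B'.
Proof. by rewrite -!row_mul; apply/rowP => j; rewrite !mxE. Qed.

(** Cyclicity of the trace. It will be used with [A] the matrix of ad_u, [J] that of the
    differential of the field, and [L] the frame. *)
Lemma trace_conj_add n (A J L : 'M[R]_n) : L \in unitmx ->
  \tr ((A *m L + L *m J) *m invmx L) = \tr A + \tr J.
Proof.
move=> Lu; rewrite mulmxDl mxtraceD mulmxK//.
by rewrite (mxtrace_mulC (L *m _)) mulmxA mulVmx// mul1mx.
Qed.

Lemma is_derive_mulmxr (V : normedModType R) m n p (M : V -> 'M[R]_(m, n))
    (B : 'M[R]_(n, p)) (x v : V) (dM : 'M[R]_(m, n)) :
  is_derive x v M dM -> is_derive x v (fun z => M z *m B) (dM *m B).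
Proof.
move=> /is_derive_mxP Md; apply/is_derive_mxP => i j.
rewrite mxE (_ : (fun z => _) = fun z => \sum_k M z i k * B k j); last first.
  by apply/funext => z; rewrite mxE.
apply: is_derive_bigsum => k.
have := is_deriveZ (B k j) (Md i k).
rewrite [in X in _ -> X]mulrC (_ : (_ \*: _) = fun z => M z i k * B k j)//.
by apply/funext => z; exact: mulrC.
Qed.

(** Unlike the directional derivatives of [is_derive_det], this gives continuity, by which the
    determinant keeps its sign near a point. *)
Lemma differentiable_det (V : normedModType R) n (M : V -> 'M[R]_n) (x : V) :
  (forall i j, differentiable (fun z => M z i j) x) ->
  differentiable (fun z => \det (M z)) x.
Proof.
move=> Md; rewrite /determinant.
elim: (index_enum _) => [|s r ih].
  rewrite (_ : (fun _ => _) = cst 0); first exact: differentiable_cst.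
  by apply/funext => z; rewrite big_nil.
rewrite (_ : (fun _ => _) = (fun z => (-1) ^+ s * \prod_i M z i (s i)) +
   (fun z => \sum_(t <- r) (-1) ^+ t * \prod_i M z i (t i))); last first.
  by apply/funext => z; rewrite big_cons.
apply: differentiableD => //; apply: differentiableM; first exact: differentiable_cst.
elim: (index_enum _) => [|i q ihq].
  rewrite (_ : (fun _ => _) = cst 1); first exact: differentiable_cst.
  by apply/funext => z; rewrite big_nil.
rewrite (_ : (fun _ => _) = (fun z => M z i (s i)) * (fun z => \prod_(j <- q) M z j (s j))).
  exact: differentiableM.
by apply/funext => z; rewrite big_cons.
Qed.

(* Along the segment from 1%:M to A every matrix is definite, hence invertible,
   so that the determinant cannot change sign. *)
Lemma det_posdef_gt0 n (A : 'M[R]_n) :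
  (forall u : 'rV[R]_n, u != 0 -> 0 < (u *m A *m u^T) 0 0) -> 0 < \det A.
Proof.
move=> Apos; rewrite ltNge; apply/negP => A0.
(* The determinant along the segment is a polynomial in the parameter, so the intermediate value
   theorem for polynomials gives a zero. It is applied to [- P], which goes from -1 to
   [- \det A]. *)
pose P : {poly R} := \det ('X *: map_mx polyC (A - 1%:M) + 1%:M).
have PE t : P.[t] = \det (t *: (A - 1%:M) + 1%:M).
  rewrite -horner_evalE -det_map_mx; congr determinant.
  apply/matrixP => i j; rewrite !mxE/= /horner_eval !hornerE.
  by case: (i == j); rewrite ?hornerE.
have [t /andP[t0 t1]] : exists2 t, 0 <= t <= 1 & root (- P) t.
  apply: poly_ivt => //; rewrite !hornerN !PE scale0r add0r det1 scale1r subrK.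
  by rewrite lerN10 oppr_ge0.
rewrite rootN /root PE => /det0P[v v0].
rewrite mulmxDr mulmx1 -scalemxAr mulmxBr mulmx1 => vM.
have vv : 0 < (v *m v^T) 0 0.
  have [i vi] : exists i, v 0 i != 0 by apply/rV0Pn.
  rewrite mxE (bigD1 i)//= mxE ltr_pwDl//.
    by rewrite -expr2 exprn_even_gt0.
  by apply: sumr_ge0 => j _; rewrite mxE -expr2 sqr_ge0.
have vA := Apos v v0.
(* Pairing the kernel vector with itself gives [t * a + (1 - t) * c = 0] with [a] and [c] positive
   and [t] between 0 and 1. *)
have : ((t *: (v *m A - v) + v) *m v^T) 0 0 = 0 by rewrite vM mul0mx mxE.
rewrite mulmxDl -scalemxAl mulmxBl !mxE.
rewrite !mxE in vA vv.
set a := \sum_j _ in vA *; set c := \sum_j _ in vv *.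
have [->|tn0] := eqVneq t 0; first by lra.
have t_gt0 : 0 < t by rewrite lt_neqAle eq_sym tn0.
have : 0 < t * a by rewrite mulr_gt0.
have : 0 <= (1 - t) * c by rewrite mulr_ge0 ?subr_ge0// ltW.
lra.
Qed.

End Matrices.

(** * Bilinearity of a Riemannian metric *)

Section Metric.
Variables (R : realType) (m : nat) (M : smoothManifoldType R m) (g : riemannian_metric M).

Lemma metricDl x u v w : g x (u + v) w = g x u w + g x v w.
Proof. by have := metric_linear g x 1 u v w; rewrite scale1r mul1r. Qed.

Lemma metric0l x w : g x 0 w = 0.
Proof. by have := metricDl x 0 0 w; rewrite addr0; lra. Qed.

Lemma metricZl x a u w : g x (a *: u) w = a * g x u w.
Proof. by have := metric_linear g x a u 0 w; rewrite addr0 metric0l addr0. Qed.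

Lemma metric_suml x I (r : seq I) (F : I -> 'rV[R]_m) w :
  g x (\sum_(i <- r) F i) w = \sum_(i <- r) g x (F i) w.
Proof.
elim: r => [|i r ih]; first by rewrite !big_nil metric0l.
by rewrite !big_cons metricDl ih.
Qed.

Lemma metric_sumr x I (r : seq I) (F : I -> 'rV[R]_m) w :
  g x w (\sum_(i <- r) F i) = \sum_(i <- r) g x w (F i).
Proof. by rewrite Defs.metric_sym metric_suml; apply: eq_bigr => i _; exact: Defs.metric_sym. Qed.

Lemma metricZr x a u w : g x w (a *: u) = a * g x w u.
Proof. by rewrite Defs.metric_sym metricZl Defs.metric_sym. Qed.

Lemma metricBl x u v w : g x (u - v) w = g x u w - g x v w.
Proof. by rewrite metricDl -scaleN1r metricZl mulN1r. Qed.

Lemma metric_mx n x (l : {linear 'rV[R]_n -> 'rV[R]_m}) (u v : 'rV[R]_n) :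
  g x (l u) (l v) =
  (u *m (\matrix_(i, j) g x (l (delta_mx 0 i)) (l (delta_mx 0 j))) *m v^T) 0 0.
Proof.
rewrite {1}(row_sum_delta u) {1}(row_sum_delta v) !linear_sum metric_sumr mxE.
apply: eq_bigr => j _; rewrite linearZ metricZr mulrC !mxE; congr (_ * _).
rewrite metric_suml; apply: eq_bigr => i _.
by rewrite linearZ metricZl mxE.
Qed.

End Metric.

(** * The divergence of a left-invariant field *)

Section Divergence.
Variables (R : realType) (m : nat) (G : lieGroupType R m).
Implicit Types (x : G) (c : chart R m G) (y z u v w : 'rV[R]_m).

Let ab : atlas (unit_chart G) := atlasb G.

(** Its rows are the left-invariant fields through the canonical basis vectors. *)
Definition frame c z : 'M[R]_m :=
  lin1_mx ('d (lmul (chart_from c z) (unit_chart G) c) (unit_coord G)).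

Lemma mul_frame c z u : u *m frame c z = lfield c u z.
Proof. exact: mul_rV_lin1. Qed.

Lemma frameE c z i j : frame c z i j = lfield c (delta_mx 0 i) z 0 j.
Proof. by rewrite mxE. Qed.

(** The differential of the translation by the inverse of the point is the inverse matrix. *)
Lemma frame_unit c z : atlas c -> chart_im c z -> frame c z \in unitmx.
Proof.
move=> ac zc; have [pc pz] := chart_imP ac zc.
pose p := chart_from c z.
pose B := lin1_mx ('d (lmul (p^-1)%g c (unit_chart G)) z).
suff FB : frame c z *m B = 1%:M by exact: (proj1 (mulmx1_unit FB)).
apply/row_matrixP => i; rewrite row_mul row1 rowE mul_frame mul_rV_lin1.
have dp : chart_dom c (p * chart_from (unit_chart G) (unit_coord G))%g.
  by rewrite from_y1 mulg1.
have d1 : chart_dom (unit_chart G) (p^-1 * p * chart_from (unit_chart G) (unit_coord G))%g.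
  by rewrite from_y1 mulg1 mulVg; exact: dom_b1.
have := diff_lmul_comp (delta_mx 0 i) ab ac ab (im_y1 G) dp d1.
rewrite (lmul_y1 p c) /p pz (mulVg p) => E.
by apply: (etrans (esym E)); exact: diff_lmul1 (im_y1 G).
Qed.

Lemma of_coord_lfield c z u : atlas c -> chart_im c z ->
  of_coord c z (lfield c u z) = left_invariant_field u (chart_from c z).
Proof.
move=> ac zc; have [pc pz] := chart_imP ac zc.
rewrite of_coordE left_invariant_fieldE /lfield; move: (chart_from c z) pc pz => p pc pz.
have dp : chart_dom c (p * chart_from (unit_chart G) (unit_coord G))%g.
  by rewrite from_y1 mulg1.
have dd : chart_dom (chart_at p) (1 * p * chart_from (unit_chart G) (unit_coord G))%g.
  by rewrite from_y1 mulg1 mul1g; exact: chart_at_dom.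
have := diff_lmul_comp u ab ac (chart_at_atlas p) (im_y1 G) dp dd.
by rewrite (lmul_y1 p c) pz (mul1g p) => /esym.
Qed.

Variables (g : riemannian_metric G) (hg : left_invariant g).

Lemma left_invariant_metric x u v :
  g x (left_invariant_field u x) (left_invariant_field v x) = g (1%g : G) u v.
Proof. by have := hg x 1%g u v; rewrite mulg1. Qed.

Let G0 : 'M[R]_m := \matrix_(i, j) g (1%g : G) (delta_mx 0 i) (delta_mx 0 j).

Lemma gram_frame c z : atlas c -> chart_im c z ->
  frame c z *m gram_coord g c z *m (frame c z)^T = G0.
Proof.
move=> ac zc; apply/matrixP => i j.
rewrite [RHS]mxE -(left_invariant_metric (chart_from c z)) -!of_coord_lfield//.
rewrite metric_mx -!mul_frame -/(gram_coord g c z).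
rewrite trmx_mul !mulmxA -(mulmxA _ (frame c z)) -(mulmxA _ (frame c z *m _)).
rewrite -rowE trmx_delta -colE.
by rewrite !mxE.
Qed.

Lemma det_gram_frame c z : atlas c -> chart_im c z ->
  \det (gram_coord g c z) * \det (frame c z) ^+ 2 = \det G0.
Proof.
move=> ac zc; rewrite -(gram_frame ac zc) !det_mulmx det_tr.
by rewrite expr2 mulrA mulrAC mulrC mulrA.
Qed.

Lemma det_gram1_gt0 : 0 < \det G0.
Proof.
apply: det_posdef_gt0 => u u0.
have := metric_mx g (1%g : G) (@idfun 'rV[R]_m) u u; rewrite /= -/G0 => <-.
exact: metric_pos.
Qed.

(** The determinant relation carries positivity from the identity to every point. *)
Lemma det_gram_gt0 c z : atlas c -> chart_im c z -> 0 < \det (gram_coord g c z).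
Proof.
move=> ac zc; have := det_gram1_gt0; rewrite -(det_gram_frame ac zc) pmulr_lgt0//.
have := frame_unit ac zc; rewrite unitmxE unitfE => d0.
by rewrite exprn_even_gt0.
Qed.

Definition dframe c y w : 'M[R]_m :=
  \matrix_(i, j) ('d (lfield c (delta_mx 0 i)) y w : 'rV[R]_m) 0 j.

Lemma is_derive_frame c y w : atlas c -> chart_im c y ->
  is_derive y w (frame c) (dframe c y w).
Proof.
move=> ac yc; apply/is_derive_mxP => i j.
rewrite mxE (_ : (fun z => _) = fun z => lfield c (delta_mx 0 i) z 0 j); last first.
  by apply/funext => z; exact: frameE.
have h := is_diff_derive w (differentiableP (differentiable_lfield (delta_mx 0 i) ac yc)).
exact: (is_derive_mxP _ _ _ _).1 h 0 j.
Qed.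

(** With [a] the components of the field, linearity in the direction collects the coordinate
    derivatives of the density into a single derivative along the field. *)
Lemma dframe_sum c y (a : 'rV[R]_m) (B : 'M[R]_m) :
  \sum_i a 0 i * \tr (dframe c y (delta_mx 0 i) *m B) = \tr (dframe c y a *m B).
Proof.
have -> : dframe c y a = \sum_i a 0 i *: dframe c y (delta_mx 0 i).
  apply/matrixP => i j; rewrite mxE {1}(row_sum_delta a) linear_sum !summxE.
  by apply: eq_bigr => k _; rewrite linearZ !mxE.
rewrite mulmx_suml (raddf_sum (@mxtrace R m)); apply: eq_bigr => i _.
by rewrite -scalemxAl; exact: esym (mxtraceZ _ _).
Qed.

(** Row [i] is the bracket formula for the fields through [u] and the [i]-th basis vector, solved
    for the derivative of the latter field; the bracket itself is the left-invariant field through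
    the bracket in the Lie algebra. *)
Lemma dframe_left_invariant x u (c := chart_at x) (y := chart_to (chart_at x) x) :
  dframe c y (lfield c u y) =
  lin1_mx (lie_alg_bracket G u) *m frame c y + frame c y *m lin1_mx ('d (lfield c u) y).
Proof.
have xK : chart_from c y = x.
  by apply: chart_fromK; [exact: chart_at_atlas|exact: chart_at_dom].
have FE v : lfield c v y = 'd (lmul x (unit_chart G) c) (unit_coord G) v.
  by rewrite /lfield xK.
apply/row_matrixP => i; rewrite row_mulD.
have E0 : row i (dframe c y (lfield c u y)) =
    'd (lfield c (delta_mx 0 i)) y (lfield c u y).
  by apply/rowP => j; rewrite !mxE.
have E1 : row i (lin1_mx (lie_alg_bracket G u)) = lie_alg_bracket G u (delta_mx 0 i).
  by apply/rowP => j; rewrite !mxE.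
have E2 : row i (frame c y) = lfield c (delta_mx 0 i) y.
  exact: etrans (rowE _ _) (mul_frame _ _ _).
have E3 : lfield c (lie_alg_bracket G u (delta_mx 0 i)) y =
    'd (lfield c (delta_mx 0 i)) y (lfield c u y)
    - 'd (lfield c u) y (lfield c (delta_mx 0 i) y).
  apply: (etrans (FE _)); apply: (etrans (esym (left_invariant_fieldE _ _))).
  apply: (etrans (esym (lie_bracket_left_invariant _ _ _))).
  apply: (etrans (lie_bracketE _ _ _)).
  exact: (f_equal2 (fun p q => p - q) (congr1 ('d (lfield c (delta_mx 0 i)) y) (esym (FE u)))
    (congr1 ('d (lfield c u) y) (esym (FE (delta_mx 0 i))))).
rewrite E0 E1 E2 mul_frame.
by apply: (esym (etrans (f_equal2 +%R E3 (mul_rV_lin1 _ _)) (subrK _ _))).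
Qed.

Lemma divergence_left_invariant u x :
  divergence g (left_invariant_field u) x = - trace_ad G u.
Proof.
set c := chart_at x; set y := chart_to c x.
have ac : atlas c by exact: chart_at_atlas.
have yc : chart_im c y by apply: chart_im_to; exact: chart_at_dom.
pose L := frame c y.
have Lu : L \in unitmx by exact: frame_unit.
(* Normalizing by the frame at [y] brings the determinant to the identity matrix, where
   [is_derive_det] applies, and makes it positive near [y], so that no absolute value appears. *)
pose H z := frame c z *m invmx L.
have Hy : H y = 1%:M by rewrite /H mulmxV.
pose vol z := Num.sqrt (\det (gram_coord g c z)).
have vol_gt0 : 0 < vol y by rewrite sqrtr_gt0 det_gram_gt0.
have Hd w : is_derive y w (fun z => \det (H z)) (\tr (dframe c y w *m invmx L)).
  by apply: is_derive_det => //; apply: is_derive_mulmxr; exact: is_derive_frame.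
have detH_gt0 : \forall z \near y, 0 < \det (H z).
  have : differentiable (fun z => \det (H z)) y.
    apply: differentiable_det => i j.
    rewrite (_ : (fun z => _) = \sum_k (fun z => lfield c (delta_mx 0 i) z 0 k * invmx L k j)).
      apply: differentiable_sum => k.
      apply: differentiableM; last exact: differentiable_cst.
      apply: (@differentiable_comp _ _ _ _ (lfield c (delta_mx 0 i)) (fun N : 'rV[R]_m => N 0 k)).
        exact: differentiable_lfield.
      exact: differentiable_coord.
    apply/funext => z; rewrite mxE fct_sumE; apply: eq_bigr => k _.
    by rewrite -frameE.
  move=> /differentiable_continuous Hc.
  have gt0 : nbhs (\det (H y)) [set t : R | 0 < t].
    by apply: open_nbhs_nbhs; split; [exact: open_gt|rewrite /= Hy det1].
  exact: (Hc _ gt0).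
(* Here [h], [l], [f] stand for the determinants of [H z], [L], [frame c z], and [a], [d] for the
   Gram determinants at [z] and [y]. *)
have cancel_sqr (h l f a d : R) : l != 0 -> f = h * l -> a * f ^+ 2 = d * l ^+ 2 ->
    h ^+ 2 * a = d.
  move=> l0 -> E; have l20 : l ^+ 2 != 0 by rewrite expf_eq0.
  by apply: (mulIf l20); rewrite -E; ring.
have sqrt_eq (h a d : R) : 0 < h -> h ^+ 2 * a = d -> Num.sqrt a * h = Num.sqrt d.
  by move=> h0 <-; rewrite sqrtrM ?sqr_ge0// sqrtr_sqr gtr0_norm// mulrC.
have volE : \forall z \near y, vol z = vol y * (\det (H z))^-1.
  have ngt := detH_gt0; have nim := near_chart_im ac yc.
  near=> z.
  have zc : chart_im c z by near: z.
  have dz : 0 < \det (H z) by near: z.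
  have detF : \det (frame c z) = \det (H z) * \det L.
    by rewrite -det_mulmx /H mulmxKV.
  apply: (mulIf (lt0r_neq0 dz)); rewrite mulfVK ?lt0r_neq0//.
  have d2 : \det (H z) ^+ 2 * \det (gram_coord g c z) = \det (gram_coord g c y).
    have E := etrans (det_gram_frame ac zc) (esym (det_gram_frame ac yc)).
    have dL : \det L != 0 by move: Lu; rewrite unitmxE unitfE.
    exact: cancel_sqr dL detF E.
  exact: sqrt_eq dz d2.
have fieldE : \forall z \near y, field_coord c (left_invariant_field u) z = lfield c u z.
  by apply: filterS (near_chart_im ac yc) => z zc; exact: field_coord_left_invariant.
have term i : 'D_(delta_mx 0 i) (fun z => vol z * field_coord c (left_invariant_field u) z 0 i) y =
    vol y * ('d (lfield c u) y (delta_mx 0 i) : 'rV[R]_m) 0 i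
    - vol y * (lfield c u y 0 i * \tr (dframe c y (delta_mx 0 i) *m invmx L)).
  have [Hdd HdE] := Hd (delta_mx 0 i).
  have dH1 : \det (H y) != 0 by rewrite Hy det1 oner_neq0.
  have Vd : is_derive y (delta_mx 0 i) (fun z => (\det (H z))^-1)
      (- \tr (dframe c y (delta_mx 0 i) *m invmx L)).
    apply: DeriveDef; first exact: derivableV.
    by rewrite deriveV// HdE Hy det1 expr1n invr1 scaleN1r.
  have Ld : is_derive y (delta_mx 0 i) (fun z => lfield c u z 0 i)
      (('d (lfield c u) y (delta_mx 0 i) : 'rV[R]_m) 0 i).
    have h := is_diff_derive (delta_mx 0 i) (differentiableP (differentiable_lfield u ac yc)).
    exact: (is_derive_mxP _ _ _ _).1 h 0 i.
  have Pd := is_deriveZ (vol y) (is_deriveM Vd Ld).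
  have nE : \forall z \near y,
      (vol y *: ((fun z => (\det (H z))^-1) * (fun z => lfield c u z 0 i))) z =
      vol z * field_coord c (left_invariant_field u) z 0 i.
    near=> z.
    have -> : vol z = vol y * (\det (H z))^-1 by near: z.
    have -> : field_coord c (left_invariant_field u) z = lfield c u z by near: z.
    by rewrite -mulrA.
  have [_ ->] := near_eq_is_derive nE Pd.
  rewrite Hy det1 invr1 scale1r -mulrBr -[LHS]/(vol y * _); congr (_ * _).
  by rewrite -[X in _ + X]/(_ * _) mulrN.
have -> : divergence g (left_invariant_field u) x = (vol y)^-1 *
    \sum_i 'D_(delta_mx 0 i) (fun z => vol z * field_coord c (left_invariant_field u) z 0 i) y.
  by [].
under eq_bigr => i _ do rewrite term.
rewrite sumrB -!mulr_sumr -mulrBr mulKf ?lt0r_neq0//.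
have E1 : \sum_i ('d (lfield c u) y (delta_mx 0 i) : 'rV[R]_m) 0 i =
    \tr (lin1_mx ('d (lfield c u) y)).
  by apply: eq_bigr => i _; rewrite mxE.
(* The density contributes the trace of the differential of the field a second time; it cancels
   against [E1]. *)
have E2 : \sum_i lfield c u y 0 i * \tr (dframe c y (delta_mx 0 i) *m invmx L) =
    trace_ad G u + \tr (lin1_mx ('d (lfield c u) y)).
  apply: (etrans (dframe_sum _ _ _ _)); apply: etrans (trace_conj_add _ _ Lu).
  exact: (congr1 (fun D => \tr (D *m invmx L)) (dframe_left_invariant x u)).
apply: (etrans (f_equal2 (fun p q => p - q) E1 E2)).
by rewrite opprD addrCA subrr addr0.
Unshelve. all: by end_near. Qed.

End Divergence.

(** * Linearity of the trace of ad *)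

Section Trace.
Variables (R : realType) (m : nat) (G : lieGroupType R m).

(** One term of the bracket is a differential applied to the first argument; in the other the field
    itself depends linearly on that argument. *)
Lemma lie_alg_bracketPl (a : R) (u u' v : 'rV[R]_m) :
  lie_alg_bracket G (a *: u + u') v = a *: lie_alg_bracket G u v + lie_alg_bracket G u' v.
Proof.
have ud w : differentiable (lfield (unit_chart G) w) (unit_coord G).
  by apply: differentiable_lfield; [exact: atlasb|exact: im_y1].
have E : 'd (lfield (unit_chart G) (a *: u + u')) (unit_coord G) v =
    a *: 'd (lfield (unit_chart G) u) (unit_coord G) v
    + 'd (lfield (unit_chart G) u') (unit_coord G) v.
  have -> : lfield (unit_chart G) (a *: u + u') =
      a *: lfield (unit_chart G) u + lfield (unit_chart G) u'.
    by apply/funext => z; exact: linearP.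
  exact: (is_diffE v (is_diffD (is_diffZ a (differentiableP (ud u))) (differentiableP (ud u')))).
have S (p q r s : 'rV[R]_m) : (a *: p + q) - (a *: r + s) = a *: (p - r) + (q - s).
  by rewrite opprD addrACA scalerBr.
rewrite !lie_alg_bracketE; apply: etrans (S _ _ _ _).
exact: (f_equal2 (fun p q => p - q) (linearP _ _ _ _) E).
Qed.

Lemma trace_adE (u : 'rV[R]_m) :
  trace_ad G u = \sum_i lie_alg_bracket G u (delta_mx 0 i) 0 i.
Proof. by apply: eq_bigr => i _; rewrite mxE. Qed.

Lemma trace_adP (a : R) (u u' : 'rV[R]_m) :
  trace_ad G (a *: u + u') = a * trace_ad G u + trace_ad G u'.
Proof.
rewrite !trace_adE mulr_sumr -big_split; apply: eq_bigr => i _.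
apply: (etrans (congr1 (fun w : 'rV[R]_m => w 0 i) (lie_alg_bracketPl a u u' (delta_mx 0 i)))).
by move: (lie_alg_bracket G u _) (lie_alg_bracket G u' _) => p q; rewrite !mxE.
Qed.

Lemma trace_ad_sum I (r : seq I) (a : I -> R) (F : I -> 'rV[R]_m) :
  trace_ad G (\sum_(i <- r) a i *: F i) = \sum_(i <- r) a i * trace_ad G (F i).
Proof.
have t0 : trace_ad G 0 = 0.
  by have := trace_adP (-1) 0 0; rewrite scaler0 addr0 mulN1r addNr.
elim: r => [|i r ih]; first by rewrite !big_nil.
by rewrite !big_cons trace_adP ih.
Qed.
End Trace.

(** * Gradients of homomorphisms into the real line *)

Section Gradient.
Variables (R : realType) (m : nat) (G : lieGroupType R m).

Lemma smooth_differentiable (W : normedModType R) (f : G -> W) (c : chart R m G) y :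
  smooth f -> atlas c -> chart_im c y -> differentiable (f \o chart_from c) y.
Proof. by move=> fs ac yc; have [h _] := fs c ac 1%N; exact: h. Qed.

(** Translation by [x] changes a homomorphism by the constant [f x], which differentiation
    removes. *)
Lemma differential_morph (W : normedModType R) (f : G -> W) (x : G) (u : 'rV[R]_m) :
  smooth f -> (forall x y : G, f (x * y)%g = f x + f y) ->
  differential f x (left_invariant_field u x) = differential f (1%g : G) u.
Proof.
move=> fs fM; set c := chart_at x.
have ac : atlas c by exact: chart_at_atlas.
pose T := lmul x (unit_chart G) c.
have domT : chart_dom c (x * chart_from (unit_chart G) (unit_coord G))%g.
  by rewrite from_y1 mulg1; exact: chart_at_dom.
have Td : differentiable T (unit_coord G).
  by apply: differentiable_lmul => //; [exact: atlasb|exact: im_y1].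
have Ty : T (unit_coord G) = chart_to c x by exact: lmul_y1.
have fcd : differentiable (f \o chart_from c) (T (unit_coord G)).
  apply: smooth_differentiable => //; rewrite Ty.
  by apply: chart_im_to; exact: chart_at_dom.
have fbd : differentiable (f \o chart_from (unit_chart G)) (unit_coord G).
  by apply: smooth_differentiable => //; [exact: atlasb|exact: im_y1].
have h1 := is_diff_comp (differentiableP Td) (differentiableP fcd).
have h2 := is_diffD (is_diff_cst (f x) (unit_coord G)) (differentiableP fbd).
have nE : \forall z \near unit_coord G, ((f \o chart_from c) \o T) z =
    (cst (f x) + (f \o chart_from (unit_chart G))) z.
  apply: filterS (near_lmul_dom (atlasb G) ac (im_y1 G) domT) => z [zb zc].
  rewrite -[RHS]/(f x + f (chart_from (unit_chart G) z)) -fM.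
  exact: (congr1 f (lmulK ac zc)).
have E1 := is_diffE u (near_eq_is_diff nE h1).
have E2 := is_diffE u h2.
rewrite left_invariant_fieldE /differential -/c -Ty.
apply: (etrans (esym E1)); apply: (etrans E2); exact: add0r.
Qed.

(** Since the frame is invertible, identities at [x] may be tested on left-invariant fields. *)
Lemma left_invariant_field_surj (x : G) (v : 'rV[R]_m) :
  exists u, v = left_invariant_field u x.
Proof.
have ac := chart_at_atlas x.
have xc : chart_im (chart_at x) (chart_to (chart_at x) x).
  by apply: chart_im_to; exact: chart_at_dom.
exists (v *m invmx (frame (chart_at x) (chart_to (chart_at x) x))).
rewrite left_invariant_fieldE.
have E : chart_from (chart_at x) (chart_to (chart_at x) x) = x.
  by apply: chart_fromK => //; exact: chart_at_dom.
apply: (etrans (esym (mulmxKV (frame_unit ac xc) v))).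
by apply: (etrans (mul_frame _ _ _)); rewrite /lfield E.
Qed.

Variables (g : riemannian_metric G) (hg : left_invariant g).

Lemma gradient_morph (f : G -> R) (A : 'rV[R]_m) :
  smooth (f : G -> R) -> (forall x y : G, f (x * y)%g = f x + f y) ->
  (forall v, g (1%g : G) A v = differential (f : G -> R) (1%g : G) v) ->
  gradient g f = left_invariant_field A.
Proof.
move=> fs fM Af; apply/funext => x; apply: get_unique.
  move=> v; have [u ->] := left_invariant_field_surj x v.
  rewrite left_invariant_metric// Af; apply/esym; exact: differential_morph.
(* Uniqueness, which determines the value of [get]: the difference [w] of two candidates is
   orthogonal to every vector, in particular to itself. *)
move=> u hu; apply/eqP; rewrite -subr_eq0; apply/negPn/negP => /(metric_pos g x).
set w := u - _; rewrite {1}/w metricBl hu.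
have [w' ->] := left_invariant_field_surj x w.
rewrite left_invariant_metric// Af (differential_morph x w' fs fM) subrr.
by rewrite ltxx.
Qed.
End Gradient.

(** * Linear functions of a map, and real and imaginary parts *)

Section CoordFun.
Variables (R : realType) (n : nat).

Lemma bform_continuous (a : 'rV[R]_n) : continuous (fun w : 'rV[R]_n => bform w a).
Proof.
move=> w; apply: differentiable_continuous.
rewrite (_ : (fun _ => _) = \sum_i (fun w : 'rV[R]_n => w 0 i * a 0 i)).
  apply: differentiable_sum => i; apply: differentiableM; last exact: differentiable_cst.
  exact: differentiable_coord.
by apply/funext => z; rewrite fct_sumE.
Qed.

Lemma smooth_bform m (M : smoothManifoldType R m) (Phi : M -> 'rV[R]_n) (a : 'rV[R]_n) :
  smooth Phi -> smooth (fun x => bform (Phi x) a).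
Proof.
move=> Ps c ac k; have [_ oc _ _ _] := atlas_chart c ac.
exact: (@Ck_on_linear R _ _ R k _ _ (bformr a) oc (@bform_continuous a) (Ps c ac k)).
Qed.

Lemma differential_bform m (M : smoothManifoldType R m) (Phi : M -> 'rV[R]_n) (a : 'rV[R]_n) x v :
  smooth Phi ->
  differential (fun x => bform (Phi x) a) x v = bform (differential Phi x v) a.
Proof.
move=> Ps.
have Pd : differentiable (Phi \o chart_from (chart_at x)) (chart_to (chart_at x) x).
  have [h _] := Ps _ (chart_at_atlas x) 1%N.
  by apply: h; exists x => //; exact: chart_at_dom.
have ld : is_diff ((Phi \o chart_from (chart_at x)) (chart_to (chart_at x) x))
    (bformr a : 'rV[R]_n -> R) (bformr a : 'rV[R]_n -> R).
  apply: DiffDef; first exact: (@linear_differentiable _ _ R (bformr a) _ (@bform_continuous a)).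
  exact: (@diff_lin _ _ R (bformr a) _ (@bform_continuous a)).
exact: (is_diffE v (is_diff_comp (differentiableP Pd) ld)).
Qed.

Lemma bformDl (K : comNzRingType) (u v w : 'rV[K]_n) : bform (u + v) w = bform u w + bform v w.
Proof. by rewrite /bform -big_split; apply: eq_bigr => i _; rewrite !mxE mulrDl. Qed.

Lemma Re_bform (p : 'rV[R]_n) (v : 'rV[R[i]]_n) :
  complex.Re (bform (map_mx (real_complex R) p) v) = bform p (map_mx (@complex.Re R) v).
Proof.
rewrite /bform raddf_sum; apply: eq_bigr => i _; rewrite !mxE.
by case: (v 0 i) => a b /=; rewrite mul0r subr0.
Qed.

Lemma Im_bform (p : 'rV[R]_n) (v : 'rV[R[i]]_n) :
  complex.Im (bform (map_mx (real_complex R) p) v) = bform p (map_mx (@complex.Im R) v).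
Proof.
rewrite /bform raddf_sum; apply: eq_bigr => i _; rewrite !mxE.
by case: (v 0 i) => a b /=; rewrite mul0r addr0.
Qed.

(** The right-hand side has the shape of [metricC], so that [kappa] can be compared with [bform]
    part by part. *)
Lemma bform_complexE (v w : 'rV[R[i]]_n) :
  let re := map_mx (@complex.Re R) in let im := map_mx (@complex.Im R) in
  bform v w = (bform (re v) (re w) - bform (im v) (im w))
    +i* (bform (re v) (im w) + bform (im v) (re w)).
Proof.
apply/eqP; rewrite eq_complex; apply/andP; split; apply/eqP; rewrite /bform [LHS]raddf_sum /=.
  by rewrite -sumrB; apply: eq_bigr => i _; rewrite !mxE; case: (v 0 i) (w 0 i) => [a b] [a' b'].
by rewrite -big_split; apply: eq_bigr => i _; rewrite !mxE; case: (v 0 i) (w 0 i) => [a b] [a' b'].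
Qed.

End CoordFun.

(** * The operators [kappa] and [tau] on the coordinate functions *)

Section RiemannianSubmersion.
Variables (R : realType) (m n : nat) (G : lieGroupType R m).
Variables (g : riemannian_metric G) (hg : left_invariant g).
Variables (Phi : G -> 'rV[R]_n) (Phi_smooth : smooth Phi).
Hypothesis PhiM : forall x y : G, Phi (x * y)%g = Phi x + Phi y.
Variable X : 'I_n -> 'rV[R]_m.
Hypothesis hX : orthonormal_basis g (1%g : G) (horizontal g Phi (1%g : G)) X.
Hypothesis hdX : forall i, differential Phi (1%g : G) (X i) = delta_mx 0 i.

Definition horizontal_lift (a : 'rV[R]_n) : 'rV[R]_m := \sum_i a 0 i *: X i.

Lemma differential_horizontal_lift (a : 'rV[R]_n) :
  differential Phi (1%g : G) (horizontal_lift a) = a.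
Proof.
rewrite [RHS]row_sum_delta /differential linear_sum; apply: eq_bigr => i _.
by rewrite linearZ; congr (_ *: _); exact: hdX.
Qed.

(** Subtracting from [v] the lift [h] of its image leaves a vertical vector, orthogonal to every
    [X i]; on [h] orthonormality gives the Euclidean product. *)
Lemma metric_horizontal_lift (a : 'rV[R]_n) (v : 'rV[R]_m) :
  g (1%g : G) (horizontal_lift a) v = bform (differential Phi (1%g : G) v) a.
Proof.
have [hor on _] := hX.
pose h := horizontal_lift (differential Phi (1%g : G) v).
have dh := differential_horizontal_lift (differential Phi (1%g : G) v).
have dvh : differential Phi (1%g : G) (v - h) = 0.
  by apply: (etrans (linearB _ _ _)); apply/eqP; rewrite subr_eq0; apply/eqP/esym.
have -> : v = h + (v - h) by rewrite addrC subrK.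
rewrite Defs.metric_sym metricDl !(Defs.metric_sym g _ _ (horizontal_lift a)).
rewrite [X in _ + X]metric_suml [X in _ + X]big1 ?addr0; last first.
  by move=> i _; rewrite metricZl (hor i _ dvh) mulr0.
rewrite metric_suml.
(* The decomposition of [v] was also substituted on the right-hand side, where it is undone here. *)
have -> : h + (v - h) = v by rewrite addrC subrK.
apply: eq_bigr => i _; rewrite metricZl mulrC; congr (_ * _).
rewrite metric_sumr (bigD1 i)//= metricZr on eqxx mulr1 big1 ?addr0// => j ji.
by rewrite metricZr on eq_sym (negbTE ji) mulr0.
Qed.

Lemma gradient_bform (a : 'rV[R]_n) :
  gradient g (fun x => bform (Phi x) a) = left_invariant_field (horizontal_lift a).
Proof.
apply: gradient_morph => //; first exact: smooth_bform.
  by move=> x y; rewrite PhiM bformDl.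
by move=> v; rewrite metric_horizontal_lift differential_bform.
Qed.

Lemma metric_gradient_bform (a b : 'rV[R]_n) x :
  g x (gradient g (fun y => bform (Phi y) a) x) (gradient g (fun y => bform (Phi y) b) x) =
  bform a b.
Proof.
rewrite !gradient_bform left_invariant_metric// metric_horizontal_lift.
rewrite differential_horizontal_lift.
by apply: eq_bigr => i _; exact: mulrC.
Qed.

Lemma laplacian_bform (a : 'rV[R]_n) x :
  laplacian g (fun y => bform (Phi y) a) x = - \sum_i a 0 i * trace_ad G (X i).
Proof.
by rewrite /laplacian gradient_bform divergence_left_invariant// trace_ad_sum.
Qed.

Lemma kappa_coord_fun (v w : 'rV[R[i]]_n) x :
  kappa g (coord_fun Phi v) (coord_fun Phi w) x = bform v w.
Proof.
have Re_fun u : (fun y => complex.Re (coord_fun Phi u y)) =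
    fun y => bform (Phi y) (map_mx (@complex.Re R) u).
  by apply/funext => y; exact: Re_bform.
have Im_fun u : (fun y => complex.Im (coord_fun Phi u y)) =
    fun y => bform (Phi y) (map_mx (@complex.Im R) u).
  by apply/funext => y; exact: Im_bform.
have reE u : map_mx (@complex.Re R) (gradientC g (coord_fun Phi u) x) =
    gradient g (fun y => bform (Phi y) (map_mx (@complex.Re R) u)) x.
  by apply/rowP => i; rewrite !mxE /= Re_fun.
have imE u : map_mx (@complex.Im R) (gradientC g (coord_fun Phi u) x) =
    gradient g (fun y => bform (Phi y) (map_mx (@complex.Im R) u)) x.
  by apply/rowP => i; rewrite !mxE /= Im_fun.
apply: etrans (esym (bform_complexE v w)).
(* This is the body of [metricC], with [p], [p'] the real and [q], [q'] the imaginary parts of the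
   two gradients. *)
pose F p p' q q' := (g x p p' - g x q q') +i* (g x p q' + g x q p').
apply: (etrans (f_equal4 F (reE v) (reE w) (imE v) (imE w))).
have gE a b := metric_gradient_bform a b x.
exact: (f_equal2 (@Complex R) (f_equal2 (fun p q => p - q) (gE _ _) (gE _ _))
  (f_equal2 +%R (gE _ _) (gE _ _))).
Qed.

Lemma tau_coord_fun (v : 'rV[R[i]]_n) x :
  tau g (coord_fun Phi v) x = - bform v (\row_i (trace_ad G (X i))%:C).
Proof.
have Re_fun : (fun y => complex.Re (coord_fun Phi v y)) =
    fun y => bform (Phi y) (map_mx (@complex.Re R) v).
  by apply/funext => y; exact: Re_bform.
have Im_fun : (fun y => complex.Im (coord_fun Phi v y)) =
    fun y => bform (Phi y) (map_mx (@complex.Im R) v).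
  by apply/funext => y; exact: Im_bform.
rewrite /tau Re_fun Im_fun !laplacian_bform.
apply/eqP; rewrite eq_complex; apply/andP; split; apply/eqP;
  rewrite /bform [RHS]raddfN [in RHS]raddf_sum /=; congr (- _); apply: eq_bigr => i _; rewrite !mxE.
  by case: (v 0 i) => a b /=; rewrite mulr0 subr0.
by case: (v 0 i) => a b /=; rewrite mulr0 add0r.
Qed.

End RiemannianSubmersion.

Theorem theorem5p2 (R : realType) (m n : nat) (G : lieGroupType R m)
    (hconn : connected [set: G]) (hsimply : simply_connected R G)
    (hn : (0 < n)%N)
    (psi : {linear abelianization G -> 'rV[R]_n}) (hpsi : bijective psi)
    (Phi : G -> 'rV[R]_n) (hPhi : natural_epimorphism psi Phi)
    (g : riemannian_metric G) (hg : left_invariant g)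
    (hsub : riemannian_submersion g Phi)
    (X : 'I_n -> 'rV[R]_m)
    (hX : orthonormal_basis g (1%g : G) (horizontal g Phi (1%g : G)) X)
    (hdX : forall i, differential Phi (1%g : G) (X i) = delta_mx 0 i)
    (xi : 'rV[R[i]]_n) (hxi : xi = \row_i (trace_ad G (X i))%:C)
    (W : {vspace 'rV[R[i]]_n}) (hW : maximal_isotropic W)
    (V : {vspace 'rV[R[i]]_n}) (hV : V = annihilated xi W)
    (hdim : (2 <= \dim V)%N) :
  orthogonal_harmonic_family g [set coord_fun Phi v | v in [set v | v \in V]].
Proof.
have [Phi_smooth PhiM _] := hPhi.
split=> [_ [v _ <-]|_ _ [v + <-] [w + <-]].
  split.
    rewrite (_ : (fun _ => _) = fun x => bform (Phi x) (map_mx (@complex.Re R) v)).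
      exact: smooth_bform.
    by apply/funext => x; exact: Re_bform.
  rewrite (_ : (fun _ => _) = fun x => bform (Phi x) (map_mx (@complex.Im R) v)).
    exact: smooth_bform.
  by apply/funext => x; exact: Im_bform.
rewrite /= hV !mem_annihilated => /andP[vW /eqP vxi] /andP[wW _].
split=> x.
  by rewrite (tau_coord_fun hg Phi_smooth PhiM hX hdX) -hxi vxi oppr0.
by rewrite (kappa_coord_fun hg Phi_smooth PhiM hX hdX); apply: (hW.1 v w).
Qed.
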